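(* For every $K>0$ there exists a monotone travelling wave solution, with profile $q$ satisfying $\mathcal{E}(q)=K$, to the equation $$u_{tt}(x,t)=\int_{-\delta}^{\delta} f\bigl(u(x+\xi,t)-u(x,t),\xi\bigr)\,d\xi ,$$ where $f(\eta,\xi)=F(\eta/\xi)\,\mathrm{sgn}(\xi)$ for $0<|\xi|\le\delta$, with $$F(s)=\begin{cases} s-\frac{s^2}{2}, & s<0,\\ s, & \text{otherwise.}\end{cases}$$
   Context: Fix $\delta>0$. A monotone travelling wave solution is a solution of the form $u(x,t)=q(x-ct)$ with $c\neq0$ a real constant and $q:\mathbb{R}\to\mathbb{R}$ monotone; equivalently, for all $z\in\mathbb{R}$, $c^2q''(z)=\int_0^\delta\bigl(f(q(z+\xi)-q(z),\xi)-f(q(z)-q(z-\xi),\xi)\bigr)\,d\xi$. The potential energy is $$\mathcal{E}(q)=\int_{\mathbb{R}}\int_0^\delta W\bigl(q(z+\xi)-q(z),\xi\bigr)\,d\xi\,dz,$$ where $W$ satisfies $\partial_\eta W=f$ and is given by $W(\eta,\xi)=\frac{\eta^2}{2|\xi|}\left(1-\frac{\eta}{3\xi}\right)$ if $\eta/\xi<0$ and $W(\eta,\xi)=\frac{\eta^2}{2|\xi|}$ otherwise. *)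

(* Defs.v *)
From HB Require Import structures.
From mathcomp Require Import all_boot all_order all_algebra.
From mathcomp Require Import all_classical all_reals all_analysis.

Set Implicit Arguments.
Unset Strict Implicit.
Unset Printing Implicit Defensive.

Import Order.TTheory GRing.Theory Num.Theory.
Import numFieldNormedType.Exports.

Local Open Scope classical_set_scope.
Local Open Scope ring_scope.

Section Peridynamics.
Context {R : realType}.
Implicit Types (delta c eta xi s x t z : R) (q : R -> R) (u : R -> R -> R).

Definition F s : R := if s < 0 then s - s ^+ 2 / 2 else s.

(* [f] and [W] are meaningful only for [xi != 0]. Their values at [xi = 0],
   where [eta / 0 = 0], enter the integrals below only on a null set. *)
Definition f eta xi : R := F (eta / xi) * Num.sg xi.

(* Antiderivative in [eta] of [f], vanishing at [eta = 0]. *)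
Definition W eta xi : R :=
  if eta / xi < 0 then eta ^+ 2 / (2 * `|xi|) * (1 - eta / (3 * xi))
  else eta ^+ 2 / (2 * `|xi|).

(* Classical solution: [u] is twice differentiable in time and the equation
   holds at every point [(x, t)]. [Rintegral] is total, hence the explicit
   integrability requirement. *)
Definition peridynamic_solution delta u : Prop :=
  forall x t,
    [/\ derivable (u x) t 1,
        derivable (derive1 (u x)) t 1,
        (@lebesgue_measure R).-integrable `[- delta, delta]
          (fun xi => (f (u (x + xi) t - u x t) xi)%:E) &
        derive1n 2 (u x) t =
          \int[@lebesgue_measure R]_(xi in `[- delta, delta])
            f (u (x + xi) t - u x t) xi].

Definition monotone_profile q : Prop :=
  {homo q : x y / x <= y} \/ {homo q : x y / x <= y >-> y <= x}.

Definition monotone_travelling_wave delta u c q : Prop :=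
  [/\ c != 0,
      monotone_profile q,
      (forall x t, u x t = q (x - c * t)) &
      peridynamic_solution delta u].

(* The integrand is nonnegative, so the integral makes sense in [\bar R]
   without an integrability assumption. *)
Definition potential_energy delta q : \bar R :=
  (\int[@lebesgue_measure R]_(z in setT)
     \int[@lebesgue_measure R]_(xi in `[0%R, delta])
       (W (q (z + xi) - q z) xi)%:E)%E.

End Peridynamics.

(* Main.v *)
(**
The profile is [q = - prim w] with [w >= 0] even and nonincreasing on the half
line, and the travelling wave equation is the Euler-Lagrange equation
[c^2 w = P'(w)] of the potential energy [P] under a constraint on [|w|^2].
For decreasing profiles [P] is the sum of a quadratic and a cubic term, both
convex and nonnegative, and [P'] preserves the class of such [w].

One minimises [|w|^2] subject to [P(w) >= K].  By convexity, replacing [w] by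
the positive multiple of [P'(w)] of the same norm does not decrease [P]; doing
this twice makes a minimising sequence bounded and uniformly Lipschitz, so it
clusters locally uniformly at some [w].  The tails contribute to [P] at most
[delta^2 / 4] times their squared norm, up to a small factor, because
monotonicity makes the cubic term negligible there; hence
[K <= P(w) + delta^2 / 4 * (m - |w|^2)], where [m] is the infimum.  A long flat
profile shows [m < 4 K / delta^2], the threshold of the quadratic term; hence
[w <> 0], and rescaling [w] to squared norm [m] keeps [P >= K].  At a minimiser
[P(w) = K], and the equality case of Cauchy-Schwarz between [w] and [P'(w)]
yields the Euler-Lagrange equation.
*)

Require Import Defs.
From HB Require Import structures.
From mathcomp Require Import all_boot all_order all_algebra.
From mathcomp Require Import all_classical all_reals all_analysis.
From mathcomp Require Import measurable_realfun ring lra.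

Set Implicit Arguments.
Unset Strict Implicit.
Unset Printing Implicit Defensive.

Import Order.TTheory GRing.Theory Num.Theory.
Import numFieldNormedType.Exports.
Local Open Scope classical_set_scope.
Local Open Scope ring_scope.

(** * Primitives of continuous functions *)

(** The law [F] is stiffened by its quadratic term only at negative strain, which is why the profile
    decreases: every bond then works where the energy is the polynomial [bond_energy]. Among even
    profiles that decrease away from 0 mass can neither drift away nor split, so flattening out is
    the only loss of compactness left. It is a real danger: the quadratic term alone admits no
    minimiser, and the gain must come from the cubic one. The only competitor used for the equation
    is the normalised gradient [tau * grad delta w], which stays in the class because [slope] is odd
    and nonpositive to the right of 0. The factor [tau] plays the part of the multiplier and fixes
    the speed by [c^2 = 1 / tau]. The minimiser is only known to be continuous; the equation
    [w = tau * grad delta w] itself makes it differentiable. *)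

HB.lock Definition prim {R : realType} (w : R -> R) (x : R) : R :=
  \int[@lebesgue_measure R]_(t in `[0, x]) w t -
  \int[@lebesgue_measure R]_(t in `[x, 0]) w t.

Section Primitive.
Context {R : realType}.
Implicit Types (v w F : R -> R) (a b x y : R).
Local Notation mu := (@lebesgue_measure R).

Lemma continuous_itv_integrable w a b : continuous w ->
  mu.-integrable `[a, b] (EFin \o w).
Proof.
move=> cw; apply: continuous_compact_integrable.
  exact: segment_compact.
exact: continuous_subspaceT.
Qed.

(** The formula for [prim] changes at 0, which obstructs the fundamental theorem of calculus there.
    A base point to the left of everything removes the case distinction; this is the only place
    where [prim] is unfolded. *)
Lemma prim_basepoint w a y : continuous w -> a < 0 -> a <= y ->
  prim w y = \int[mu]_(t in `[a, y]) w t - \int[mu]_(t in `[a, 0]) w t.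
Proof.
move=> cw a0 ay; rewrite unlock.
have [y0|y0] := ltP y 0.
  rewrite set_itv_ge ?bnd_simp -?ltNge// Rintegral_set0 sub0r.
  have := @Rintegral_itvB _ w (BLeft a) (BRight 0) y (continuous_itv_integrable _ _ cw).
  rewrite !bnd_simp => /(_ ay (ltW y0)) E.
  rewrite -Rintegral_itv_obnd_cbnd; first by rewrite -E opprB.
  by apply: integrableS (continuous_itv_integrable y 0 cw) => //; exact: subset_itv_oc_cc.
have := @Rintegral_itvB _ w (BLeft a) (BRight y) 0 (continuous_itv_integrable _ _ cw).
rewrite !bnd_simp => /(_ (ltW a0) y0) ->.
rewrite Rintegral_itv_obnd_cbnd; last first.
  by apply: integrableS (continuous_itv_integrable 0 y cw) => //; exact: subset_itv_oc_cc.
have [->|yn0] := eqVneq y 0; first by rewrite set_itv1 Rintegral_set1 subr0.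
rewrite (@set_itv_ge _ _ (BLeft y)) ?bnd_simp -?ltNge ?Rintegral_set0 ?subr0//.
by rewrite lt_neqAle eq_sym yn0.
Qed.

Lemma prim_derive w x : continuous w -> is_derive x 1 (prim w) (w x).
Proof.
(* This point lies to the left of both 0 and [x], so near [x] the primitive is an integral with
   fixed lower end minus a constant. *)
move=> cw; pose a := - `|x| - 1.
have nx := normr_ge0 x.
have a0 : a < 0 by rewrite /a; lra.
have ax : a < x by rewrite /a; have := ler_norm (- x); rewrite normrN; lra.
have x1 : x < x + 1 by lra.
have iw : mu.-integrable [set` Interval (BLeft a) (BRight (x + 1))] (EFin \o w).
  exact: continuous_itv_integrable.
have [dF F'] := continuous_FTC1_closed x1 iw ax (cw x).
apply: (@near_eq_is_derive _ _ _
  ((fun y => \int[mu]_(t in `[a, y]) w t) - cst (\int[mu]_(t in `[a, 0]) w t))).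
  near=> y; rewrite (prim_basepoint cw a0)//; apply/ltW.
  by near: y; exact: lt_nbhsr.
rewrite -[w x]subr0; apply: is_deriveB.
apply: DeriveDef; first exact: dF.
by rewrite -derive1E; exact: F'.
Unshelve. all: by end_near. Qed.

Lemma derive_MVT F w a b : (forall x, is_derive x 1 F (w x)) -> a <= b ->
  exists2 c, a <= c <= b & F b - F a = w c * (b - a).
Proof.
move=> dF ab.
have [|c + E] := @MVT_segment _ F w a b ab; last by exists c.
apply: continuous_subspaceT => x.
by apply/differentiable_continuous/derivable1_diffP; have [] := dF x.
Qed.

Lemma derive_continuous F w : (forall x, is_derive x 1 F (w x)) -> continuous F.
Proof.
move=> dF x; apply/differentiable_continuous/derivable1_diffP.
by have [] := dF x.
Qed.

Lemma prim_continuous w : continuous w -> continuous (prim w).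
Proof. by move=> cw; apply: (@derive_continuous _ w) => x; exact: prim_derive. Qed.

(** The mean value theorem for [G - F]. Comparing increments of antiderivatives in this way avoids
    integrability conditions; most bounds on [gap] come from it. *)
Lemma prim_le F G v w a b : (forall x, is_derive x 1 F (v x)) ->
  (forall x, is_derive x 1 G (w x)) -> a <= b ->
  (forall x, a <= x <= b -> v x <= w x) -> F b - F a <= G b - G a.
Proof.
move=> dF dG ab vw.
have [c cab E] := @derive_MVT (G - F) (w - v) a b (fun x => is_deriveB (dG x) (dF x)) ab.
have : 0 <= (w c - v c) * (b - a) by rewrite mulr_ge0 ?subr_ge0// vw.
by move: E; rewrite !fctE => <-; lra.
Qed.

Lemma prim_eq F v a b : continuous v -> (forall x, is_derive x 1 F (v x)) ->
  prim v b - prim v a = F b - F a.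
Proof.
move=> cv dF; wlog ab : a b / a <= b.
  move=> H; have [/H//|/ltW/H] := leP a b; lra.
have dP x : is_derive x 1 (prim v) (v x) by exact: prim_derive.
apply/eqP; rewrite eq_le; apply/andP; split.
  exact: (@prim_le _ _ v v).
exact: (@prim_le _ _ v v).
Qed.

Lemma integral_prim w a b : continuous w -> a <= b ->
  (\int[mu]_(x in `[a, b]) (w x)%:E)%E = (prim w b - prim w a)%:E.
Proof.
move=> cw; rewrite le_eqVlt => /predU1P[<-|ab].
  by rewrite set_itv1 integral_set1 subrr.
rewrite EFinB; apply: continuous_FTC2 => //.
- exact: continuous_subspaceT.
- split.
  + by move=> x _; have [] := prim_derive x cw.
  + by apply: cvg_at_right_filter; exact: prim_continuous.
  + by apply: cvg_at_left_filter; exact: prim_continuous.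
- by move=> x _; rewrite derive1E; have [] := prim_derive x cw.
Qed.

End Primitive.

(** * Tonelli's theorem for sections and windows *)

Section Sections.
Context {R : realType}.
Local Notation mu := (@lebesgue_measure R).
Local Notation mR := (measurableTypeR R).
Local Open Scope ereal_scope.

Lemma patch_section (T : Type) (S : set (T * mR)) (f : T * mR -> \bar R) t :
  (fun z => f (t, z)) \_ [set z | S (t, z)] = (fun z => (f \_ S) (t, z)).
Proof.
by apply/funext => z; rewrite !patchE; congr (if _ then _ else _); rewrite !in_setE /=.
Qed.

(** Extending the integrand by zero off [S] turns an integral over a varying section into one over
    the whole line, where Tonelli's theorem applies. *)
Lemma section_integral_measurable d (T : measurableType d) (S : set (T * mR))
    (f : T * mR -> \bar R) : measurable S -> measurable_fun S f ->
  (forall p, S p -> 0 <= f p) ->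
  measurable_fun setT (fun t => \int[mu]_(z in [set z | S (t, z)]) f (t, z)).
Proof.
move=> mS mf f0; under eq_fun => t do rewrite integral_mkcond patch_section.
apply: (measurable_fun_fubini_tonelli_F (m2 := mu) (f \_ S)) => //.
  exact: (measurable_restrictT f mS).1.
by move=> p; exact: erestrict_ge0.
Qed.

Lemma section_tonelli (S : set (mR * mR)) (f : mR * mR -> \bar R) :
  measurable S -> measurable_fun S f -> (forall p, S p -> 0 <= f p) ->
  \int[mu]_x \int[mu]_(y in [set y | S (x, y)]) f (x, y) =
  \int[mu]_y \int[mu]_(x in [set x | S (x, y)]) f (x, y).
Proof.
move=> mS mf f0; under eq_integral => x _ do rewrite integral_mkcond patch_section.
rewrite (fubini_tonelli (m1 := mu) (m2 := mu) (f \_ S)); last 2 first.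
- exact: (measurable_restrictT f mS).1.
- by move=> p; exact: erestrict_ge0.
apply: eq_integral => y _; rewrite [RHS]integral_mkcond.
apply: eq_integral => x _.
by rewrite !patchE; congr (if _ then _ else _); rewrite !in_setE /=.
Qed.

Lemma tonelli_in (D E : set mR) (f : mR -> mR -> \bar R) :
  measurable D -> measurable E -> measurable_fun (D `*` E) (fun p => f p.1 p.2) ->
  (forall x y, D x -> E y -> 0 <= f x y) ->
  \int[mu]_(x in D) \int[mu]_(y in E) f x y =
  \int[mu]_(y in E) \int[mu]_(x in D) f x y.
Proof.
move=> mD mE mf f0.
have mDE : measurable (D `*` E) by exact: measurableX.
have := @section_tonelli (D `*` E) (fun p => f p.1 p.2) mDE mf
  (fun p DEp => f0 _ _ DEp.1 DEp.2) => /= H.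
rewrite integral_mkcond [RHS]integral_mkcond; move: H => /=.
have HD (A B : set mR) (g : mR -> mR -> \bar R) :
    (fun x => \int[mu]_(y in [set y | A x /\ B y]) g x y) =
    (fun x => \int[mu]_(y in B) g x y) \_ A.
  apply/funext => x; rewrite patchE; case: ifPn => [|/negP]; rewrite ?in_setE => Ax.
    by congr (integral _ _ _); apply: eq_set => y /=; apply/propext; split => // -[].
  rewrite [X in integral _ X _](_ : _ = set0) ?integral_set0//.
  by apply/seteqP; split => y //= -[].
rewrite (HD D E) => ->; rewrite -(HD E D (fun y x => f x y)).
apply: eq_integral => y _; congr (integral _ _ _).
by apply: eq_set => x /=; apply/propext; tauto.
Qed.

Lemma integral_in_measurable d (T : measurableType d) (D : set T) (E : set mR)
    (f : T -> mR -> \bar R) :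
  measurable D -> measurable E -> measurable_fun (D `*` E) (fun p => f p.1 p.2) ->
  (forall x y, D x -> E y -> 0 <= f x y) ->
  measurable_fun D (fun x => \int[mu]_(y in E) f x y).
Proof.
move=> mD mE mf f0.
have mDE : measurable (D `*` E) by exact: measurableX.
have := @section_integral_measurable _ _ (D `*` E) (fun p => f p.1 p.2) mDE mf
  (fun p DEp => f0 _ _ DEp.1 DEp.2) => /= H.
apply: (eq_measurable_fun (fun x => \int[mu]_(y in [set y | (D `*` E) (x, y)]) f x y)).
  move=> x; rewrite inE => Dx; congr (integral _ _ _).
  by apply: eq_set => y /=; apply/propext; split => // -[].
exact: measurable_funTS.
Qed.

Lemma measurable_window (a b : R) :
  measurable [set p : mR * mR | (p.1 - a <= p.2 <= p.1 + b)%R].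
Proof.
have m1 : measurable_fun setT (fun p : mR * mR => p.1) by exact: measurable_fst.
have m2 : measurable_fun setT (fun p : mR * mR => p.2) by exact: measurable_snd.
rewrite [X in measurable X](_ : _ = [set p : mR * mR | (p.1 - a <= p.2)%R] `&`
   [set p : mR * mR | (p.2 <= p.1 + b)%R]); last first.
  by apply/seteqP; split => [p /= /andP[]//|p /= [-> ->]].
rewrite -[X in X `&` _]setTI -[X in _ `&` X]setTI.
apply: measurableI.
  by apply: measurable_fun_ler => //; exact: measurable_funB.
by apply: measurable_fun_ler => //; exact: measurable_funD.
Qed.

Lemma window_integral_measurable (v : mR -> \bar R) (a b : R) :
  measurable_fun setT v -> (forall x, 0 <= v x) ->
  measurable_fun setT (fun z : mR => \int[mu]_(x in `[(z - a)%R, (z + b)%R]) v x).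
Proof.
move=> mv v0; have mv2 : measurable_fun setT (fun p : mR * mR => v p.2).
  exact: (measurableT_comp mv measurable_snd).
have := section_integral_measurable (measurable_window a b) (measurable_funTS mv2)
  (fun p _ => v0 p.2).
by congr (measurable_fun _ _); apply/funext => z; congr (integral _ _ _).
Qed.

Lemma itv_integralZl (c : \bar R) (v : mR -> \bar R) (a b : R) :
  measurable_fun setT v -> (forall x, 0 <= v x) -> 0 <= c ->
  \int[mu]_(x in `[a, b]) (c * v x) = c * \int[mu]_(x in `[a, b]) v x.
Proof.
move=> mv v0 c0; have mvi : measurable_fun (`[a, b]%classic : set mR) v.
  exact: measurable_funTS.
exact: (ge0_integralZl mu (measurable_itv _) mvi (fun x _ => v0 x) c0).
Qed.

(** The condition [z - a <= x <= z + b], solved for [z], reads [x - b <= z <= x + a]: exchanging the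
    integrals reflects the window. *)
Lemma window_tonelli (g v : mR -> \bar R) (a b : R) :
  measurable_fun setT g -> measurable_fun setT v ->
  (forall x, 0 <= g x) -> (forall x, 0 <= v x) ->
  \int[mu]_z (g z * \int[mu]_(x in `[(z - a)%R, (z + b)%R]) v x) =
  \int[mu]_x (v x * \int[mu]_(z in `[(x - b)%R, (x + a)%R]) g z).
Proof.
move=> mg mv g0 v0.
have mgv : measurable_fun setT (fun p : mR * mR => g p.1 * v p.2).
  by apply: emeasurable_funM; apply: measurableT_comp.
have := @section_tonelli _ (fun p : mR * mR => g p.1 * v p.2) (measurable_window a b)
  (measurable_funTS mgv) (fun p _ => mule_ge0 (g0 _) (v0 _)) => /= H.
transitivity (\int[mu]_x \int[mu]_(y in [set y | (x - a <= y <= x + b)%R]) (g x * v y)).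
  apply: eq_integral => z _.
  rewrite (_ : [set y | _] = `[(z - a)%R, (z + b)%R]%classic); last first.
    by apply: eq_set => x /=; rewrite in_itv.
  by rewrite itv_integralZl.
rewrite H; apply: eq_integral => x _.
rewrite (_ : [set z | _] = `[(x - b)%R, (x + a)%R]%classic); last first.
  apply: eq_set => z /=.
  by rewrite in_itv/= [(x - b <= z)%R]lerBlDr [(z - a <= x)%R]lerBlDr andbC.
under eq_integral do rewrite muleC.
by rewrite itv_integralZl.
Qed.

End Sections.

(** * Profiles and their increments *)

Section Gap.
Context {R : realType}.
Implicit Types (v w F : R -> R) (a b x y z xi : R).
Local Notation mu := (@lebesgue_measure R).
Local Notation mR := (measurableTypeR R).

(** The third clause contains both evenness and monotonicity: applied in both directions when
    [|x| = |y|], it gives [profile_opp]. *)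
Definition profile w : Prop :=
  [/\ continuous w, (forall x, 0 <= w x) &
      (forall x y, `|x| <= `|y| -> w y <= w x)].

(** For [q = - prim w] this is [q z - q (z + xi)], the amount by which the bond of length [xi] based
    at [z] is shortened. *)
Definition gap w xi z : R := prim w (z + xi) - prim w z.

(** For [b >= 0] and [xi >= 0] this is [W (- b) xi], and [bond_force] is its derivative in [b]; see
    [W_energy] and [f_tension]. *)
Definition bond_energy b xi : R := b ^+ 2 / (2 * xi) + b ^+ 3 / (6 * xi ^+ 2).

Definition bond_force b xi : R := b / xi + b ^+ 2 / (2 * xi ^+ 2).

Lemma continuous_sqr w : continuous w -> continuous (fun x => w x ^+ 2).
Proof.
move=> cw x; rewrite (_ : (fun x => _) = w \* w); last by apply/funext.
exact: (continuousM (cw x) (cw x)).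
Qed.

Lemma is_derive_affine F f a c x : (forall x, is_derive x 1 F (f x)) ->
  is_derive x 1 (fun s => F (a + c * s)) (c * f (a + c * x)).
Proof.
move=> dF.
have da : is_derive x 1 (cst a + (c \*o id)) (0 + c *: 1) by apply: is_deriveD.
have := is_derive1_comp (dF _) da; rewrite add0r [_ *: _]mulr1 mulrC.
exact.
Qed.

(** [F y - F (- y)] has derivative [f y + f (- y) = 0] and vanishes at 0. *)
Lemma odd_derive_even F f x : (forall x, is_derive x 1 F (f x)) ->
  (forall x, f (- x) = - f x) -> F (- x) = F x.
Proof.
move=> dF oddf; have dN (y : R) : is_derive y 1 (fun y => F y - F (0 + - 1 * y)) 0.
  have := is_deriveB (dF y) (@is_derive_affine _ _ 0 (- 1) y dF).
  by rewrite mulN1r add0r mulN1r oddf opprK subrr.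
have := is_derive_0_is_cst x 0 dN; rewrite mulr0 addr0 subrr add0r mulN1r => /eqP.
by rewrite subr_eq0 => /eqP ->.
Qed.

Lemma gap_derive w xi z : continuous w ->
  is_derive z 1 (gap w xi) (w (z + xi) - w z).
Proof.
move=> cw; have dP x : is_derive x 1 (prim w) (w x) by exact: prim_derive.
apply: is_deriveB; have := @is_derive_affine _ _ xi 1 z dP.
rewrite !mul1r addrC; congr (is_derive _ _ _ _).
by apply/funext => s; rewrite mul1r addrC.
Qed.

Lemma gap_continuous w xi : continuous w -> continuous (gap w xi).
Proof.
move=> cw; apply: (@derive_continuous _ _ (fun z => w (z + xi) - w z)) => z.
exact: gap_derive.
Qed.

Lemma gap_le v w xi z : continuous v -> continuous w -> 0 <= xi ->
  (forall x, z <= x <= z + xi -> v x <= w x) -> gap v xi z <= gap w xi z.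
Proof.
move=> cv cw xi0 vw.
have dv x : is_derive x 1 (prim v) (v x) by exact: prim_derive.
have dw x : is_derive x 1 (prim w) (w x) by exact: prim_derive.
by apply: (@prim_le _ _ _ v w); rewrite ?lerDl.
Qed.

Lemma gap_cst M xi z : gap (cst M) xi z = M * xi.
Proof.
have dM x : is_derive x 1 (fun x => M * x) (cst M x).
  have := is_deriveZ M (is_derive_id x (1 : R)); by rewrite [_ *: _]mulr1.
by rewrite /gap (prim_eq _ _ (@cst_continuous _ _ _) dM); lra.
Qed.

Lemma gapZ w k xi z : continuous w -> gap (fun x => k * w x) xi z = k * gap w xi z.
Proof.
move=> cw; have dP x : is_derive x 1 (prim w) (w x) by exact: prim_derive.
have ck : continuous (fun x => k * w x).
  by move=> x; apply: cvgM; [exact: cvg_cst|exact: cw].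
have dk x : is_derive x 1 (fun x => k * prim w x) (k * w x) by exact: is_deriveZ.
by rewrite /gap (prim_eq _ _ ck dk) mulrBr.
Qed.

Lemma gap_ge0 w xi z : continuous w -> (forall x, 0 <= w x) -> 0 <= xi -> 0 <= gap w xi z.
Proof.
move=> cw w0 xi0; rewrite -[0](mul0r xi) -(gap_cst 0 xi z).
by apply: gap_le => //; exact: cst_continuous.
Qed.

Lemma gap_ub w M xi z : continuous w -> 0 <= xi ->
  (forall x, z <= x <= z + xi -> w x <= M) -> gap w xi z <= M * xi.
Proof.
by move=> cw xi0 wM; rewrite -(gap_cst M xi z); apply: gap_le => //; exact: cst_continuous.
Qed.

Lemma gap_opp w xi z : continuous w -> (forall x, w (- x) = w x) ->
  gap w xi (- z - xi) = gap w xi z.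
Proof.
move=> cw ew; have dP y : is_derive y 1 (prim w) (w y) by exact: prim_derive.
have dN x : is_derive x 1 (fun x => - prim w (0 + - 1 * x)) (w x).
  have := is_deriveN (@is_derive_affine _ _ 0 (- 1) x dP).
  by rewrite mulN1r opprK add0r mulN1r ew.
rewrite /gap subrK (prim_eq _ _ cw dN).
have -> : 0 + -1 * - z = z by ring.
have -> : 0 + -1 * (- z - xi) = z + xi by ring.
by rewrite opprK addrC.
Qed.

(** For [0 <= s <= xi] the point [x - s] is at most as far from 0 as [x + s], so running outward
    from [x] the left window collects more. This is the source of [slope_le0]. *)
Lemma gap_sub_le w xi x : profile w -> 0 <= x -> 0 <= xi ->
  gap w xi x <= gap w xi (x - xi).
Proof.
move=> [cw w0 ew] x0 xi0.
have dP y : is_derive y 1 (prim w) (w y) by exact: prim_derive.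
pose F (s : R) : R := prim w (x + 1 * s); pose G (s : R) : R := - prim w (x + - 1 * s).
have dF (s : R) : is_derive s 1 F (1 * w (x + 1 * s)) by exact: is_derive_affine.
have dG (s : R) : is_derive s 1 G (- (- 1 * w (x + - 1 * s))).
  by apply: is_deriveN; exact: is_derive_affine.
have := @prim_le _ F G (fun s => 1 * w (x + 1 * s)) _ 0 xi dF dG xi0.
rewrite /F /G /gap !mul1r !mulN1r oppr0 addr0 subrK opprK addrC [leRHS]addrC.
apply => s /andP[s0 sxi]; rewrite mul1r mulN1r opprK mul1r; apply: ew.
rewrite [leRHS]ger0_norm ?addr_ge0// ler_norml; apply/andP; split; lra.
Qed.

(** Cauchy-Schwarz on one window: [2 l w - l^2 <= w^2] is integrated with [l] the mean of [w], the
    value that makes it sharpest. *)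
Lemma gap_sqr_le w xi z : continuous w -> 0 <= xi ->
  gap w xi z ^+ 2 <= xi * gap (fun x => w x ^+ 2) xi z.
Proof.
move=> cw; rewrite le_eqVlt => /predU1P[<-|xi0].
  by rewrite /gap addr0 !subrr expr0n mul0r.
have cw2 := continuous_sqr cw.
pose l := gap w xi z / xi.
have dP y : is_derive y 1 (prim w) (w y) by exact: prim_derive.
have dP2 y : is_derive y 1 (prim (fun x => w x ^+ 2)) (w y ^+ 2) by exact: prim_derive.
pose F (y : R) : R := 2 * l * prim w y - l ^+ 2 * y.
have dF (y : R) : is_derive y 1 F (2 * l * w y - l ^+ 2 * 1).
  by apply: is_deriveB; apply: is_deriveZ.
have := @prim_le _ F _ _ _ z (z + xi) dF dP2.
rewrite lerDl => /(_ (ltW xi0)).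
have -> : F (z + xi) - F z = gap w xi z ^+ 2 / xi.
  rewrite /F /l /gap; field; lra.
move=> H; rewrite [leRHS]mulrC -ler_pdivrMr//; apply: H => y _.
by have := sqr_ge0 (w y - l); lra.
Qed.

End Gap.

(** * Energy and force of a single bond *)

Section Bond.
Context {R : realType}.
Implicit Types (v w : R -> R) (a b t s z xi : R).
Local Notation mu := (@lebesgue_measure R).
Local Notation mR := (measurableTypeR R).

(** With [i = xi^-1] as a variable, the inequalities below become polynomial and hold for all
    [i >= 0]. Length zero is then included, because [0^-1 = 0]. *)
Lemma bond_energyE b xi :
  bond_energy b xi = b ^+ 2 * xi^-1 / 2 + b ^+ 3 * xi^-1 ^+ 2 / 6.
Proof. by rewrite /bond_energy !invfM; set i := xi^-1; field. Qed.

Lemma bond_forceE b xi :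
  bond_force b xi = b * xi^-1 + b ^+ 2 * xi^-1 ^+ 2 / 2.
Proof. by rewrite /bond_force !invfM; set i := xi^-1; field. Qed.

Lemma bond_energy_ge0 b xi : 0 <= b -> 0 <= xi -> 0 <= bond_energy b xi.
Proof.
move=> b0 xi0; rewrite bond_energyE; have i0 : 0 <= xi^-1 by rewrite invr_ge0.
by rewrite addr_ge0// !mulr_ge0// exprn_ge0.
Qed.

Lemma bond_force_ge0 b xi : 0 <= b -> 0 <= xi -> 0 <= bond_force b xi.
Proof.
move=> b0 xi0; rewrite bond_forceE; have i0 : 0 <= xi^-1 by rewrite invr_ge0.
by rewrite addr_ge0// !mulr_ge0// exprn_ge0.
Qed.

(** Energy minus tangent line is [(b - a)^2] times [i / 2 + (b + 2 a) i^2 / 6], where [i = xi^-1].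
    The cubic term ties the sign to nonnegative [a] and [b]. *)
Lemma bond_energy_convex a b xi : 0 <= a -> 0 <= b -> 0 <= xi ->
  bond_energy a xi + bond_force a xi * b <= bond_energy b xi + bond_force a xi * a.
Proof.
move=> a0 b0 xi0; rewrite !bond_energyE bond_forceE.
have i0 : 0 <= xi^-1 by rewrite invr_ge0.
rewrite -subr_ge0; set i := xi^-1 in i0 *.
have -> : b ^+ 2 * i / 2 + b ^+ 3 * i ^+ 2 / 6 +
    (a * i + a ^+ 2 * i ^+ 2 / 2) * a -
    (a ^+ 2 * i / 2 + a ^+ 3 * i ^+ 2 / 6 + (a * i + a ^+ 2 * i ^+ 2 / 2) * b) =
    (b - a) ^+ 2 * (i / 2) + (b - a) ^+ 2 * (b + 2 * a) * (i ^+ 2 / 6) by field.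
move: (sqr_ge0 (b - a)); move: ((b - a) ^+ 2) => q q0.
by rewrite addr_ge0// ?mulr_ge0 ?addr_ge0 ?mulr_ge0 ?exprn_ge0.
Qed.

Lemma bond_energy_le_force b xi : 0 <= b -> 0 <= xi ->
  2 * bond_energy b xi <= bond_force b xi * b.
Proof.
move=> b0 xi0; rewrite bond_energyE bond_forceE -subr_ge0.
have i0 : 0 <= xi^-1 by rewrite invr_ge0.
set i := xi^-1 in i0 *.
have -> : (b * i + b ^+ 2 * i ^+ 2 / 2) * b -
   2 * (b ^+ 2 * i / 2 + b ^+ 3 * i ^+ 2 / 6) = b ^+ 3 * i ^+ 2 / 6 by field.
by rewrite !mulr_ge0 ?exprn_ge0.
Qed.

(** The two terms have degrees 2 and 3: the smaller factor is [t^2] for [t >= 1], and [t^3] for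
    [t <= 1] in [bond_energyZ_le1]. *)
Lemma bond_energyZ_ge1 t b xi : 0 <= b -> 0 <= xi -> 1 <= t ->
  t ^+ 2 * bond_energy b xi <= bond_energy (t * b) xi.
Proof.
move=> b0 xi0 t1; rewrite !bond_energyE -subr_ge0.
have i0 : 0 <= xi^-1 by rewrite invr_ge0.
set i := xi^-1 in i0 *.
have -> : (t * b) ^+ 2 * i / 2 + (t * b) ^+ 3 * i ^+ 2 / 6 -
   t ^+ 2 * (b ^+ 2 * i / 2 + b ^+ 3 * i ^+ 2 / 6) =
   t ^+ 2 * (t - 1) * (b ^+ 3 * i ^+ 2 / 6) by field.
by rewrite !mulr_ge0 ?subr_ge0 ?exprn_ge0// (le_trans _ t1).
Qed.

Lemma bond_energyZ_le1 t b xi : 0 <= b -> 0 <= xi -> 0 <= t <= 1 ->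
  t ^+ 3 * bond_energy b xi <= bond_energy (t * b) xi.
Proof.
move=> b0 xi0 /andP[t0 t1]; rewrite !bond_energyE -subr_ge0.
have i0 : 0 <= xi^-1 by rewrite invr_ge0.
set i := xi^-1 in i0 *.
have -> : (t * b) ^+ 2 * i / 2 + (t * b) ^+ 3 * i ^+ 2 / 6 -
   t ^+ 3 * (b ^+ 2 * i / 2 + b ^+ 3 * i ^+ 2 / 6) =
   t ^+ 2 * (1 - t) * (b ^+ 2 * i / 2) by field.
by rewrite !mulr_ge0 ?subr_ge0 ?exprn_ge0.
Qed.

Lemma divr_bound b M xi : 0 <= M -> 0 <= b <= M * xi -> 0 <= xi ->
  b * xi^-1 <= M.
Proof.
move=> M0 /andP[b0 bM]; rewrite le_eqVlt => /predU1P[<-|xi0].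
  by rewrite invr0 mulr0.
by rewrite ler_pdivrMr.
Qed.

(** The cubic term is [b / (3 xi)] times the quadratic one, whence the 3 in the hypothesis. *)
Lemma bond_energy_le b s xi : 0 <= s -> 0 <= xi -> 0 <= b <= 3 * s * xi ->
  bond_energy b xi <= (1 + s) * (b ^+ 2 * xi^-1 / 2).
Proof.
move=> s0 xi0 bs; have [b0 _] := andP bs.
have i0 : 0 <= xi^-1 by rewrite invr_ge0.
have bi : b * xi^-1 <= 3 * s by apply: divr_bound; rewrite ?mulr_ge0.
rewrite bond_energyE -subr_ge0; set i := xi^-1 in i0 bi *.
have -> : (1 + s) * (b ^+ 2 * i / 2) - (b ^+ 2 * i / 2 + b ^+ 3 * i ^+ 2 / 6) =
  (b ^+ 2 * i / 6) * (3 * s - b * i) by field.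
by rewrite !mulr_ge0 ?subr_ge0 ?exprn_ge0.
Qed.

Lemma bond_force_le b M xi : 0 <= M -> 0 <= xi -> 0 <= b <= M * xi ->
  bond_force b xi <= M + M ^+ 2 / 2.
Proof.
move=> M0 xi0 bM; have [b0 _] := andP bM.
have bi : b * xi^-1 <= M by exact: divr_bound.
have bi0 : 0 <= b * xi^-1 by rewrite mulr_ge0// invr_ge0.
rewrite bond_forceE -exprMn lerD// ler_pM2r ?invr_gt0//.
by rewrite ler_sqr ?nnegrE.
Qed.

Lemma measurable_invr : measurable_fun setT (fun x : R => x^-1).
Proof.
rewrite -(setUv [set (0 : R)]); apply/measurable_funU => //.
  exact: measurableC.
split; first exact: measurable_fun_set1.
apply: open_continuous_measurable_fun.
  by rewrite openC; exact: closed_eq.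
by move=> x; rewrite inE/= => x0; apply: inv_continuous; exact/eqP.
Qed.

Lemma measurable_gap w : continuous w ->
  measurable_fun setT (fun p : mR * mR => gap w p.1 p.2 : R).
Proof.
move=> cw; have mp : measurable_fun setT (prim w).
  by apply: continuous_measurable_fun; exact: prim_continuous.
apply: measurable_funB.
  by apply: measurableT_comp => //; apply: measurable_funD.
by apply: measurableT_comp.
Qed.

Lemma measurable_bond_energy d (T : measurableType d) (b xi : T -> R) :
  measurable_fun setT b -> measurable_fun setT xi ->
  measurable_fun setT (fun x => bond_energy (b x) (xi x)).
Proof.
move=> mb mxi; under eq_fun do rewrite bond_energyE.
have mi : measurable_fun setT (fun x => (xi x)^-1).
  by apply: measurableT_comp => //; exact: measurable_invr.
apply: measurable_funD; apply: measurable_funM => //; apply: measurable_funM => //;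
  exact: measurable_funX.
Qed.

Lemma measurable_bond_force d (T : measurableType d) (b xi : T -> R) :
  measurable_fun setT b -> measurable_fun setT xi ->
  measurable_fun setT (fun x => bond_force (b x) (xi x)).
Proof.
move=> mb mxi; under eq_fun do rewrite bond_forceE.
have mi : measurable_fun setT (fun x => (xi x)^-1).
  by apply: measurableT_comp => //; exact: measurable_invr.
apply: measurable_funD; apply: measurable_funM => //; apply: measurable_funM => //;
  exact: measurable_funX.
Qed.

End Bond.

(** * Double integrals over bond lengths and base points *)

Section DoubleIntegral.
Context {R : realType} (delta : R).
Implicit Types (f g : R -> R -> R) (A : set R).
Local Notation mu := (@lebesgue_measure R).
Local Notation mR := (measurableTypeR R).
Local Notation D := (`[0, delta]%classic : set R).

Definition bint A f : \bar R :=
  (\int[mu]_(xi in D) \int[mu]_(z in A) (f xi z)%:E)%E.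

(** Nonnegativity is asked for [xi >= 0] only, the range of the outer integral, because [gap]
    changes sign with [xi]. *)
Definition bond_fun f : Prop :=
  measurable_fun setT (fun p : mR * mR => f p.1 p.2 : R) /\
  (forall xi z, 0 <= xi -> 0 <= f xi z).

Lemma bond_fun_ge0 f xi z : bond_fun f -> D xi -> (0 <= (f xi z)%:E)%E.
Proof. by move=> [_ f0] /=; rewrite in_itv/= lee_fin => /andP[xi0 _]; exact: f0. Qed.

Lemma bond_fun_meas f xi A : bond_fun f -> measurable_fun A (fun z => (f xi z)%:E).
Proof.
move=> [mf _]; apply/measurable_EFinP; apply: measurable_funTS.
exact: (measurable_fun_pair2 (xi : mR) mf).
Qed.

Lemma bond_fun_inner_meas f A : measurable A -> bond_fun f ->
  measurable_fun D (fun xi => \int[mu]_(z in A) (f xi z)%:E)%E.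
Proof.
move=> mA bf; apply: (@integral_in_measurable R _ mR D A (fun x y => (f x y)%:E)) => //.
  by apply/measurable_EFinP; apply: measurable_funTS; exact: bf.1.
by move=> xi z Dxi _; exact: bond_fun_ge0.
Qed.

Lemma bond_fun_inner_ge0 f A xi : bond_fun f -> D xi ->
  (0 <= \int[mu]_(z in A) (f xi z)%:E)%E.
Proof. by move=> bf Dxi; apply: integral_ge0 => z _; exact: bond_fun_ge0. Qed.

Lemma bint_le f g A : measurable A -> bond_fun f -> bond_fun g ->
  (forall xi z, 0 <= xi <= delta -> A z -> f xi z <= g xi z) ->
  (bint A f <= bint A g)%E.
Proof.
move=> mA bf bg fg; apply: ge0_le_integral => //.
- by move=> xi Dxi; exact: bond_fun_inner_ge0.
- exact: bond_fun_inner_meas.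
- exact: bond_fun_inner_meas.
- move=> xi Dxi; apply: ge0_le_integral => //.
  + by move=> z _; exact: bond_fun_ge0.
  + exact: bond_fun_meas.
  + exact: bond_fun_meas.
  + by move=> z Az; rewrite lee_fin; apply: fg => //; move: Dxi => /=; rewrite in_itv.
Qed.

Lemma bond_funD f g : bond_fun f -> bond_fun g -> bond_fun (fun xi z => f xi z + g xi z).
Proof.
move=> [mf f0] [mg g0]; split; first exact: measurable_funD.
by move=> xi z xi0; rewrite addr_ge0 ?f0 ?g0.
Qed.

Lemma bond_funZ k f : 0 <= k -> bond_fun f -> bond_fun (fun xi z => k * f xi z).
Proof.
move=> k0 [mf f0]; split; first exact: measurable_funM.
by move=> xi z xi0; rewrite mulr_ge0 ?f0.
Qed.

Lemma bintD f g A : measurable A -> bond_fun f -> bond_fun g ->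
  (bint A (fun xi z => f xi z + g xi z)%R = bint A f + bint A g)%E.
Proof.
move=> mA bf bg; rewrite -ge0_integralD//; last 4 first.
- by move=> xi Dxi; exact: bond_fun_inner_ge0.
- exact: bond_fun_inner_meas.
- by move=> xi Dxi; exact: bond_fun_inner_ge0.
- exact: bond_fun_inner_meas.
apply: eq_integral => xi /[!inE] Dxi; rewrite -ge0_integralD//.
- by move=> z _; exact: bond_fun_ge0.
- exact: bond_fun_meas.
- by move=> z _; exact: bond_fun_ge0.
- exact: bond_fun_meas.
Qed.

Lemma bintZ k f A : measurable A -> 0 <= k -> bond_fun f ->
  (bint A (fun xi z => k * f xi z)%R = k%:E * bint A f)%E.
Proof.
move=> mA k0 bf; rewrite -ge0_integralZl//; last 2 first.
- exact: bond_fun_inner_meas.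
- by move=> xi Dxi; exact: bond_fun_inner_ge0.
apply: eq_integral => xi /[!inE] Dxi; rewrite -ge0_integralZl//.
- exact: bond_fun_meas.
- by move=> z _; exact: bond_fun_ge0.
Qed.

Lemma bint_setC f A : measurable A -> bond_fun f ->
  (bint setT f = bint A f + bint (~` A) f)%E.
Proof.
move=> mA bf; have mAc : measurable (~` A) by exact: measurableC.
rewrite -ge0_integralD//; last 4 first.
- by move=> xi Dxi; exact: bond_fun_inner_ge0.
- exact: bond_fun_inner_meas.
- by move=> xi Dxi; exact: bond_fun_inner_ge0.
- exact: bond_fun_inner_meas.
apply: eq_integral => xi /[!inE] Dxi; rewrite -(setUv A) ge0_integral_setU//.
- exact: bond_fun_meas.
- by move=> z _; exact: bond_fun_ge0.
- by rewrite disj_set2E setICr.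
Qed.

Lemma bint_swap f A : measurable A -> bond_fun f ->
  bint A f = (\int[mu]_(z in A) \int[mu]_(xi in D) (f xi z)%:E)%E.
Proof.
move=> mA bf; apply: (@tonelli_in R D A (fun x y => (f x y)%:E)) => //.
  by apply/measurable_EFinP; apply: measurable_funTS; exact: bf.1.
by move=> xi z Dxi _; exact: bond_fun_ge0.
Qed.

Lemma bint_ge0 f A : bond_fun f -> (0 <= bint A f)%E.
Proof. by move=> bf; apply: integral_ge0 => xi Dxi; exact: bond_fun_inner_ge0. Qed.

Lemma bint_subset f A : measurable A -> bond_fun f -> (bint A f <= bint setT f)%E.
Proof.
move=> mA bf; rewrite (bint_setC mA bf) leeDl//.
exact: bint_ge0.
Qed.

End DoubleIntegral.

(** * The potential energy and its gradient *)

Section Gradient.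
Context {R : realType} (delta : R).
Implicit Types (v w : R -> R) (A : set R) (x z xi : R).
Local Notation mu := (@lebesgue_measure R).
Local Notation mR := (measurableTypeR R).
Local Notation D := (`[0, delta]%classic : set R).

Definition tension w xi z : R := bond_force (gap w xi z) xi.

Definition density w xi z : R := bond_energy (gap w xi z) xi.

Definition potential w : \bar R := bint delta setT (density w).

Definition inner v w : \bar R := (\int[mu]_x (v x * w x)%:E)%E.

(* [flux w xi] is the tension carried across a point by the bonds of length [xi]. *)
Definition flux w xi x : R := \int[mu]_(z in `[x - xi, x]) tension w xi z.

(** The gradient of [potential] with respect to [inner]: by [pairing], testing it against [v] gives
    the work of all tensions along the gaps of [v]. *)
Definition grad w x : R := \int[mu]_(xi in D) flux w xi x.

Lemma tension_bond_fun w : continuous w -> (forall x, 0 <= w x) -> bond_fun (tension w).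
Proof.
move=> cw w0; split; last by move=> xi z xi0; rewrite bond_force_ge0// gap_ge0.
by apply: measurable_bond_force; [exact: measurable_gap|exact: measurable_fst].
Qed.

Lemma density_bond_fun w : continuous w -> (forall x, 0 <= w x) -> bond_fun (density w).
Proof.
move=> cw w0; split; last by move=> xi z xi0; rewrite bond_energy_ge0// gap_ge0.
by apply: measurable_bond_energy; [exact: measurable_gap|exact: measurable_fst].
Qed.

Lemma gap_bond_fun w : continuous w -> (forall x, 0 <= w x) -> bond_fun (gap w).
Proof.
move=> cw w0; split; last by move=> xi z xi0; rewrite gap_ge0.
exact: measurable_gap.
Qed.

Lemma bond_funM (f g : R -> R -> R) : bond_fun f -> bond_fun g ->
  bond_fun (fun xi z => f xi z * g xi z).
Proof.
move=> [mf f0] [mg g0]; split; first exact: measurable_funM.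
by move=> xi z xi0; rewrite mulr_ge0 ?f0 ?g0.
Qed.

Lemma tension_continuous w xi : continuous w -> continuous (tension w xi).
Proof.
move=> cw x; have cg := gap_continuous (xi := xi) cw.
rewrite (_ : tension w xi =
  (fun z => gap w xi z * xi^-1 + gap w xi z ^+ 2 * (xi^-1 ^+ 2 / 2))); last first.
  by apply/funext => z; rewrite /tension bond_forceE -[X in _ + X = _]mulrA.
apply: cvgD; apply: cvgM; [exact: cg|exact: cvg_cst|exact: continuous_sqr|exact: cvg_cst].
Qed.

Lemma profile_le0 w x : profile w -> w x <= w 0.
Proof. by move=> [_ _ ew]; apply: ew; rewrite normr0. Qed.

Lemma gap_le0 w xi z : profile w -> 0 <= xi -> gap w xi z <= w 0 * xi.
Proof.
by move=> pw xi0; have [cw _ _] := pw; apply: gap_ub => // x _; exact: profile_le0.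
Qed.

(** The force at strain [w 0], the largest strain of a profile by [gap_le0]. *)
Definition tension_max w : R := w 0 + w 0 ^+ 2 / 2.

Lemma tension_le w xi z : profile w -> 0 <= xi -> tension w xi z <= tension_max w.
Proof.
move=> pw xi0; have [cw w0 _] := pw.
by apply: bond_force_le; rewrite ?gap_ge0 ?gap_le0.
Qed.

Lemma flux_gap w xi x : profile w -> 0 <= xi -> flux w xi x = gap (tension w xi) xi (x - xi).
Proof.
move=> [cw _ _] xi0; rewrite /flux /Rintegral integral_prim//=.
- by rewrite /gap subrK.
- exact: tension_continuous.
- lra.
Qed.

(** For negative [xi] the interval is empty and both sides are 0. The identity thus holds on the
    whole plane, as [measurable_flux] requires. *)
Lemma integral_flux w xi x : profile w ->
  (\int[mu]_(z in `[(x - xi)%R, x]) (tension w xi z)%:E)%E = (flux w xi x)%:E.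
Proof.
move=> [cw _ _]; rewrite /flux /Rintegral.
have [xi0|xi0] := leP 0 xi.
  by rewrite integral_prim//; [exact: tension_continuous|lra].
by rewrite set_itv_ge ?integral_set0// bnd_simp; lra.
Qed.

Lemma flux_ge0 w xi x : profile w -> 0 <= xi -> 0 <= flux w xi x.
Proof.
move=> pw xi0; have [cw w0 _] := pw; rewrite flux_gap//; apply: gap_ge0 => //.
  exact: tension_continuous.
by move=> z; exact: (tension_bond_fun cw w0).2.
Qed.

Lemma flux_le w xi x M : profile w -> 0 <= xi ->
  (forall z, x - xi <= z <= x -> tension w xi z <= M) -> flux w xi x <= M * xi.
Proof.
move=> pw xi0 H; have [cw w0 _] := pw; rewrite flux_gap//; apply: gap_ub => //.
  exact: tension_continuous.
by move=> z; rewrite subrK => ?; exact: H.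
Qed.

Lemma measurable_flux w : profile w ->
  measurable_fun setT (fun p : mR * mR => flux w p.1 p.2 : R).
Proof.
move=> pw; have [cw w0 _] := pw; apply/measurable_EFinP.
pose S : set (mR * mR * mR) := [set p | p.1.2 - p.1.1 <= p.2 <= p.1.2].
have m11 : measurable_fun setT (fun p : mR * mR * mR => p.1.1).
  exact: (measurableT_comp measurable_fst measurable_fst).
have m12 : measurable_fun setT (fun p : mR * mR * mR => p.1.2).
  exact: (measurableT_comp measurable_snd measurable_fst).
have m2 : measurable_fun setT (fun p : mR * mR * mR => p.2) by exact: measurable_snd.
have mS : measurable S.
  rewrite [X in measurable X](_ : _ = [set p : mR * mR * mR | (p.1.2 - p.1.1 <= p.2)%R] `&`
   [set p : mR * mR * mR | (p.2 <= p.1.2)%R]); last first.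
    by apply/seteqP; split => [p /andP[]//|p [h1 h2]]; apply/andP.
  rewrite -[X in X `&` _]setTI -[X in _ `&` X]setTI.
  apply: measurableI.
    by apply: measurable_fun_ler => //; exact: measurable_funB.
  by apply: measurable_fun_ler.
pose f (p : mR * mR * mR) : \bar R := (tension w p.1.1 p.2)%:E.
have mf : measurable_fun S f.
  apply: measurable_funTS; apply/measurable_EFinP.
  apply: (measurableT_comp (tension_bond_fun cw w0).1 (g := fun p => (p.1.1, p.2))).
  exact: measurable_fun_pair.
have f0 p : S p -> (0 <= f p)%E.
  rewrite /S /f /= lee_fin => /andP[h1 h2].
  by apply: (tension_bond_fun cw w0).2; move: (le_trans h1 h2); rewrite lerBlDr lerDl.
have := section_integral_measurable mS mf f0.
congr (measurable_fun _ _); apply/funext => -[xi x] /=.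
by rewrite -integral_flux.
Qed.

Lemma flux_integrable w x : profile w -> mu.-integrable D (EFin \o flux w ^~ x).
Proof.
move=> pw; have [cw w0 _] := pw.
have mfx : measurable_fun D (flux w ^~ x).
  by apply: measurable_funTS; exact: (measurable_fun_pair1 (x : mR) (measurable_flux pw)).
apply: (@le_integrable _ _ _ mu D _ _ (EFin \o (fun xi => tension_max w * xi))) => //.
- exact/measurable_EFinP.
- move=> xi /=; rewrite in_itv/= lee_fin => /andP[xi0 _].
  rewrite ger0_norm ?flux_ge0// (le_trans _ (ler_norm _))// flux_le// => z _.
  exact: tension_le.
- apply: continuous_itv_integrable => x'; apply: cvgM; [exact: cvg_cst|exact: cvg_id].
Qed.

Lemma integral_grad w x : profile w ->
  (\int[mu]_(xi in D) (flux w xi x)%:E)%E = (grad w x)%:E.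
Proof.
move=> pw; rewrite /grad /Rintegral fineK//.
by have /integrable_fin_num := flux_integrable x pw; apply.
Qed.

Lemma grad_ge0 w x : profile w -> 0 <= grad w x.
Proof.
move=> pw; apply: Rintegral_ge0 => xi /=; rewrite in_itv/= => /andP[xi0 _].
exact: flux_ge0.
Qed.

(** [gap v xi z] is the integral of [v] over [z <= x <= z + xi]. After exchanging integrals, [v x]
    is weighted by the tensions with [x - xi <= z <= x], which is [flux]; a second exchange brings
    the integral over [xi] inside. *)
Lemma pairing v w : profile v -> profile w ->
  bint delta setT (fun xi z => tension w xi z * gap v xi z) = inner (grad w) v.
Proof.
move=> pv pw; have [cv v0 _] := pv; have [cw w0 _] := pw.
have mv : measurable_fun setT v by exact: continuous_measurable_fun.
transitivity (bint delta setT (fun xi x => v x * flux w xi x)).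
  apply: eq_integral => xi /[!inE]/=; rewrite in_itv/= => /andP[xi0 _].
  transitivity (\int[mu]_z ((tension w xi z)%:E *
    \int[mu]_(x in `[(z - 0)%R, (z + xi)%R]) (v x)%:E))%E.
    apply: eq_integral => z _; rewrite EFinM subr0 integral_prim//; lra.
  rewrite window_tonelli.
  - by apply: eq_integral => x _; rewrite addr0 integral_flux// EFinM.
  - apply/measurable_EFinP; have ct := @tension_continuous w xi cw.
    exact: continuous_measurable_fun.
  - exact/measurable_EFinP.
  - by move=> z; rewrite lee_fin; exact: (tension_bond_fun cw w0).2.
  - by move=> z; rewrite lee_fin.
have bf : bond_fun (fun xi x : R => v x * flux w xi x).
  split => [|xi x xi0]; last by rewrite mulr_ge0 ?flux_ge0.
  apply: measurable_funM; last exact: measurable_flux.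
  exact: (measurableT_comp mv measurable_snd).
rewrite bint_swap//; apply: eq_integral => x _.
rewrite mulrC EFinM -integral_grad// -ge0_integralZl//.
- by have /integrableP[] := flux_integrable x pw.
- by move=> xi /=; rewrite in_itv/= lee_fin => /andP[xi0 _]; exact: flux_ge0.
- by rewrite lee_fin.
Qed.

End Gradient.

(** * Regularity of the gradient and invariance of the class of profiles *)

Section GradientProfile.
Context {R : realType} (delta : R) (delta_gt0 : 0 < delta).
Implicit Types (v w : R -> R) (A : set R) (x z xi : R).
Local Notation mu := (@lebesgue_measure R).
Local Notation mR := (measurableTypeR R).
Local Notation D := (`[0, delta]%classic : set R).

Definition slope w x : R :=
  \int[mu]_(xi in D) (tension w xi x - tension w xi (x - xi)).

Lemma flux_derive w xi x : profile w -> 0 <= xi ->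
  is_derive x 1 (flux w xi) (tension w xi x - tension w xi (x - xi)).
Proof.
move=> pw xi0; have [cw w0 _] := pw.
have ct := @tension_continuous _ w xi cw.
have dg (y : R) :
    is_derive y 1 (gap (tension w xi) xi) (tension w xi (y + xi) - tension w xi y).
  exact: gap_derive.
have := @is_derive_affine _ _ _ (- xi) 1 x dg.
rewrite !mul1r [- xi + x]addrC subrK; congr (is_derive _ _ _ _).
by apply/funext => y; rewrite mul1r addrC flux_gap.
Qed.

Lemma tension_diff_le w xi x : profile w -> 0 <= xi ->
  `|tension w xi x - tension w xi (x - xi)| <= tension_max w.
Proof.
move=> pw xi0; have [cw w0 _] := pw.
have h1 := tension_le x pw xi0; have h2 := tension_le (x - xi) pw xi0.
have h3 := (tension_bond_fun cw w0).2 xi x xi0.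
have h4 := (tension_bond_fun cw w0).2 xi (x - xi) xi0.
by rewrite ler_norml; apply/andP; split; lra.
Qed.

Lemma tension_max_ge0 w : profile w -> 0 <= tension_max w.
Proof. by move=> [_ w0 _]; rewrite addr_ge0// mulr_ge0// exprn_ge0. Qed.

Lemma tension_diff_integrable w x : profile w ->
  mu.-integrable D (EFin \o (fun xi => tension w xi x - tension w xi (x - xi))).
Proof.
move=> pw; have [cw w0 _] := pw; have [mt _] := tension_bond_fun cw w0.
apply: (@le_integrable _ _ _ mu D _ _ (EFin \o cst (tension_max w))) => //.
- apply/measurable_EFinP; apply: measurable_funTS; apply: measurable_funB.
    exact: (measurable_fun_pair1 (x : mR) mt).
  have ms : measurable_fun setT (fun xi : mR => (xi, x - xi) : mR * mR).
    by apply: measurable_fun_pair => //; exact: measurable_funB.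
  exact: (measurableT_comp mt ms).
- move=> xi /=; rewrite in_itv/= lee_fin => /andP[xi0 _].
  by rewrite [leRHS]ger0_norm ?tension_max_ge0// tension_diff_le.
- by apply: continuous_itv_integrable; exact: cst_continuous.
Qed.

(** Differentiation under the integral over [xi]. The constant majorant [tension_max w] serves at
    every point, so any interval around [x] will do. *)
Lemma grad_derive w x : profile w -> is_derive x 1 (grad delta w) (slope w x).
Proof.
move=> pw; have [cw w0 _] := pw.
have d1E xi y : D xi -> partial1of2 (fun x xi => flux w xi x) y xi =
    tension w xi y - tension w xi (y - xi).
  rewrite /= in_itv/= => /andP[xi0 _]; rewrite partial1of2E.
  by have [] := flux_derive y pw xi0.
have Ia : (`]x - 1, x + 1[%classic : set R) x by rewrite /= in_itv/=; apply/andP; split; lra.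
have mD : measurable (D : set mR) by [].
have intf y : (`]x - 1, x + 1[%classic : set R) y ->
    mu.-integrable D (EFin \o (fun xi => flux w xi y)).
  by move=> _; exact: flux_integrable.
have der y xi : (`]x - 1, x + 1[%classic : set R) y -> D xi ->
    derivable ((fun x xi => flux w xi x) ^~ xi) y 1.
  move=> _ /=; rewrite in_itv/= => /andP[xi0 _].
  by have [] := flux_derive y pw xi0.
have G0 (y : mR) : 0 <= cst (tension_max w) y by exact: tension_max_ge0.
have iG : mu.-integrable D (EFin \o cst (tension_max w)).
  by apply: continuous_itv_integrable; exact: cst_continuous.
have Gub y xi : (`]x - 1, x + 1[%classic : set R) y -> D xi ->
    `|partial1of2 (fun x xi => flux w xi x) y xi| <= cst (tension_max w) xi.
  move=> _ Dxi; rewrite d1E//; move: Dxi => /=; rewrite in_itv/= => /andP[xi0 _].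
  exact: tension_diff_le.
apply: DeriveDef.
  exact: (derivable_under_integral mD Ia intf der G0 iG Gub).
rewrite -derive1E.
have -> := differentiation_under_integral mD Ia intf der G0 iG Gub.
by apply: eq_Rintegral => xi /[!inE] Dxi; rewrite d1E.
Qed.

Lemma integral_D_cst (k : R) : (\int[mu]_(xi in D) k%:E = (k * delta)%:E)%E.
Proof.
by rewrite integral_cst//= lebesgue_measure_itv/= lte_fin delta_gt0 sube0 EFinM.
Qed.

Lemma slope_le w x : profile w -> `|slope w x| <= delta * tension_max w.
Proof.
move=> pw; have it := tension_diff_integrable x pw.
apply: (le_trans (le_normr_Rintegral _ it)) => //.
apply: (@le_trans _ _ (\int[mu]_(xi in D) cst (tension_max w) xi)).
  apply: le_Rintegral => //.
  - exact: (integrable_norm it).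
  - by apply: continuous_itv_integrable; exact: cst_continuous.
  - by move=> xi /=; rewrite in_itv/= => /andP[xi0 _]; exact: tension_diff_le.
by rewrite /Rintegral integral_D_cst/= mulrC.
Qed.

Lemma profile_opp w x : profile w -> w (- x) = w x.
Proof. by move=> [_ _ ew]; apply/eqP; rewrite eq_le !ew// normrN. Qed.

Lemma tension_opp w xi z : profile w -> tension w xi (- z - xi) = tension w xi z.
Proof.
by move=> pw; have [cw _ _] := pw; rewrite /tension gap_opp// => x; exact: profile_opp.
Qed.

(** Reflection exchanges the two tensions of the integrand: the bond based at [- x] mirrors the one
    based at [x - xi]. *)
Lemma slope_opp w x : profile w -> slope w (- x) = - slope w x.
Proof.
move=> pw; rewrite /slope -[RHS]mulN1r -RintegralZl//; last exact: tension_diff_integrable.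
apply: eq_Rintegral => xi _; rewrite mulN1r opprB tension_opp//.
by rewrite (_ : - x = - (x - xi) - xi) ?tension_opp//; ring.
Qed.

Lemma bond_force_homo xi a b : 0 <= xi -> 0 <= a -> a <= b ->
  bond_force a xi <= bond_force b xi.
Proof.
move=> xi0 a0 ab; rewrite !bond_forceE; have b0 := le_trans a0 ab.
have i0 : 0 <= xi^-1 by rewrite invr_ge0.
apply: lerD; first exact: ler_wpM2r.
apply: ler_wpM2r => //; apply: ler_wpM2r; first exact: exprn_ge0.
by rewrite ler_sqr ?nnegrE.
Qed.

Lemma slope_le0 w x : profile w -> 0 <= x -> slope w x <= 0.
Proof.
move=> pw x0; have [cw w0 _] := pw.
rewrite -oppr_ge0 -mulN1r -RintegralZl//; last exact: tension_diff_integrable.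
apply: Rintegral_ge0 => xi /=; rewrite in_itv/= => /andP[xi0 _].
rewrite mulN1r opprB subr_ge0; apply: bond_force_homo; rewrite ?gap_ge0//.
exact: gap_sub_le.
Qed.

Lemma grad_continuous w : profile w -> continuous (grad delta w).
Proof. by move=> pw; apply: (@derive_continuous _ _ (slope w)) => x; exact: grad_derive. Qed.

Lemma grad_profile w : profile w -> profile (grad delta w).
Proof.
move=> pw; have dg (x : R) : is_derive x 1 (grad delta w) (slope w x) by exact: grad_derive.
have even x : grad delta w (- x) = grad delta w x.
  by apply: (odd_derive_even x dg) => y; exact: slope_opp.
have dec x y : 0 <= x -> x <= y -> grad delta w y <= grad delta w x.
  move=> x0 xy; have [c /andP[xc _]] := derive_MVT dg xy.
  have := slope_le0 pw (le_trans x0 xc) => sc E.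
  by rewrite -subr_le0 E mulr_le0_ge0// subr_ge0.
split; [exact: grad_continuous|by move=> x; exact: grad_ge0|].
have nE x : grad delta w `|x| = grad delta w x.
  by have [_|_] := ger0P x; rewrite ?even.
by move=> x y xy; rewrite -nE -[leRHS]nE; exact: dec.
Qed.

Lemma grad_lipschitz w x y : profile w ->
  `|grad delta w x - grad delta w y| <= delta * tension_max w * `|x - y|.
Proof.
move=> pw; have dg (z : R) : is_derive z 1 (grad delta w) (slope w z) by exact: grad_derive.
wlog xy : x y / y <= x.
  move=> H; have [|/ltW yx] := leP y x; first exact: H.
  by rewrite distrC (distrC x); exact: H.
have [c _ ->] := derive_MVT dg xy.
by rewrite normrM ler_wpM2r// slope_le.
Qed.

End GradientProfile.

(** * Norms, and bounds on the gradient *)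

Section Estimates.
Context {R : realType} (delta : R) (delta_gt0 : 0 < delta).
Implicit Types (v w : R -> R) (A : set R) (x z xi : R).
Local Notation mu := (@lebesgue_measure R).
Local Notation mR := (measurableTypeR R).
Local Notation D := (`[0, delta]%classic : set R).

Lemma continuous_EFin_measurable w (A : set mR) : continuous w ->
  measurable_fun A (fun x => (w x)%:E).
Proof.
move=> cw; apply/measurable_EFinP; apply: measurable_funTS.
exact: continuous_measurable_fun.
Qed.

Lemma continuous_mul v w : continuous v -> continuous w ->
  continuous (fun x => v x * w x).
Proof. by move=> cv cw x; apply: cvgM; [exact: cv|exact: cw]. Qed.

Lemma continuous_scale k w : continuous w -> continuous (fun x => k * w x).
Proof. by move=> cw; apply: continuous_mul => //; exact: cst_continuous. Qed.

Lemma inner_ge0 v w : (forall x, 0 <= v x) -> (forall x, 0 <= w x) -> (0 <= inner v w)%E.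
Proof. by move=> v0 w0; apply: integral_ge0 => x _; rewrite lee_fin mulr_ge0. Qed.

Lemma sqnorm_ge0 w : (0 <= inner w w)%E.
Proof. by apply: integral_ge0 => x _; rewrite lee_fin -expr2 sqr_ge0. Qed.

Lemma innerZ k v w : continuous v -> continuous w -> (forall x, 0 <= v x) ->
  (forall x, 0 <= w x) -> 0 <= k -> (inner v (fun x => k * w x)%R = k%:E * inner v w)%E.
Proof.
move=> cv cw v0 w0 k0; rewrite -ge0_integralZl//.
- by apply: eq_integral => x _; rewrite -EFinM mulrCA.
- by apply: continuous_EFin_measurable; exact: continuous_mul.
- by move=> x _; rewrite lee_fin mulr_ge0.
Qed.

Lemma sqnormZ k w : continuous w ->
  (inner (fun x => k * w x)%R (fun x => k * w x)%R = (k ^+ 2)%:E * inner w w)%E.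
Proof.
move=> cw; rewrite -ge0_integralZl//.
- by apply: eq_integral => x _; rewrite -EFinM; congr EFin; ring.
- by apply: continuous_EFin_measurable; exact: continuous_mul.
- by move=> x _; rewrite lee_fin -expr2 sqr_ge0.
- by rewrite lee_fin sqr_ge0.
Qed.

(** The square of [k v - w], integrated. The free [k] carries the Cauchy-Schwarz inequality in a
    form that remains meaningful for infinite values; [sqr_le_of_young] optimises it. *)
Lemma inner_young k v w : continuous v -> continuous w -> (forall x, 0 <= v x) ->
  (forall x, 0 <= w x) -> 0 <= k ->
  ((2 * k)%:E * inner v w <= (k ^+ 2)%:E * inner v v + inner w w)%E.
Proof.
move=> cv cw v0 w0 k0.
have cvw := continuous_mul cv cw; have cvv := continuous_mul cv cv.
have cww := continuous_mul cw cw.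
rewrite -ge0_integralZl//; last 3 first.
- exact: continuous_EFin_measurable.
- by move=> x _; rewrite lee_fin mulr_ge0.
- by rewrite lee_fin mulr_ge0.
rewrite -ge0_integralZl//; last 3 first.
- exact: continuous_EFin_measurable.
- by move=> x _; rewrite lee_fin mulr_ge0.
- by rewrite lee_fin sqr_ge0.
rewrite -ge0_integralD//; last 4 first.
- by move=> x _; rewrite -EFinM lee_fin !mulr_ge0// sqr_ge0.
- by apply: measurable_funeM; exact: continuous_EFin_measurable.
- by move=> x _; rewrite lee_fin mulr_ge0.
- exact: continuous_EFin_measurable.
apply: ge0_le_integral => //.
- by move=> x _; rewrite -EFinM lee_fin !mulr_ge0.
- by apply: measurable_funeM; exact: continuous_EFin_measurable.
- apply: emeasurable_funD; last exact: continuous_EFin_measurable.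
  by apply: measurable_funeM; exact: continuous_EFin_measurable.
- move=> x _; rewrite -!EFinM -EFinD lee_fin.
  by have := sqr_ge0 (k * v x - w x); lra.
Qed.

Lemma sqnorm_gt0 w x : continuous w -> w x != 0 -> (0 < inner w w)%E.
Proof.
move=> cw wx.
have c2 : {for x, continuous (fun x => w x * w x)} by exact: continuous_mul.
have wx2 : 0 < w x * w x by rewrite -expr2 exprn_even_gt0.
have [e /= e0 H] : \forall y \near x, w x * w x / 2 < w y * w y.
  by apply: (cvgr_gt _ c2); lra.
have He y : x <= y <= x + e / 2 -> w x * w x / 2 < w y * w y.
  by move=> /andP[h1 h2]; apply: H; rewrite /ball_/= ltr_norml; apply/andP; split; lra.
apply: (@lt_le_trans _ _ (\int[mu]_(y in `[x, (x + e / 2)%R]) (w x * w x / 2)%:E)%E).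
  rewrite integral_cst//= lebesgue_measure_itv/= lte_fin ifT; last lra.
  by rewrite -EFinB -EFinM lte_fin mulr_gt0; lra.
apply: (@le_trans _ _ (\int[mu]_(y in `[x, (x + e / 2)%R]) (w y * w y)%:E)%E).
  apply: ge0_le_integral => //.
  - by move=> y _; rewrite lee_fin; lra.
  - by apply: continuous_EFin_measurable; exact: continuous_mul.
  - by move=> y /=; rewrite in_itv/= lee_fin => /He/ltW.
apply: ge0_subset_integral => //.
- by apply: continuous_EFin_measurable; exact: continuous_mul.
- by move=> y _; rewrite lee_fin -expr2 sqr_ge0.
Qed.

Lemma sqnorm_eq0 w x : continuous w -> inner w w = 0%E -> w x = 0.
Proof.
by move=> cw w0; apply: contra_eq w0 => wx; rewrite gt_eqF// (sqnorm_gt0 cw wx).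
Qed.

Lemma gap_sqr_le_norm w N xi z : continuous w -> 0 <= xi -> (inner w w <= N%:E)%E ->
  gap (fun x => w x ^+ 2) xi z <= N.
Proof.
move=> cw xi0 wN; rewrite -lee_fin; apply: (le_trans _ wN).
rewrite /gap -integral_prim//; [|exact: continuous_sqr|lra].
apply: ge0_subset_integral => //.
- by apply: continuous_EFin_measurable; exact: continuous_mul.
- by move=> y _; rewrite lee_fin sqr_ge0.
Qed.

(** A bound free of [w 0]. With [s = gap w xi z / xi], the force [s + s^2 / 2] is at most
    [1 / 2 + s^2], and [s^2 <= N / xi] by [gap_sqr_le]; hence a flux is at most [xi / 2 + N]. *)
Lemma grad_le w N x : profile w -> (inner w w <= N%:E)%E ->
  grad delta w x <= delta * (delta / 2 + N).
Proof.
move=> pw wN; have [cw w0 _] := pw.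
have N0 : 0 <= N by rewrite -lee_fin (le_trans _ wN)// sqnorm_ge0.
have gN (xi z : R) : 0 <= xi -> gap (fun x => w x ^+ 2) xi z <= N.
  by move=> xi0; exact: gap_sqr_le_norm.
clear wN; rewrite -[leRHS]mulrC -lee_fin -integral_D_cst// -integral_grad//.
apply: ge0_le_integral => //.
- by move=> xi /=; rewrite in_itv/= lee_fin => /andP[xi0 _]; exact: flux_ge0.
- by have /integrableP[] := flux_integrable delta x pw.
move=> xi /=; rewrite in_itv/= lee_fin => /andP[].
rewrite le_eqVlt => /predU1P[<-|xi0] xid.
  by rewrite flux_gap// /gap addr0 subrr addr_ge0// divr_ge0// ltW.
have : flux w xi x <= (1 / 2 + N / xi) * xi.
  apply: flux_le => //; first exact: ltW.
  move=> z _; rewrite /tension bond_forceE.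
  have : gap w xi z ^+ 2 * xi^-1 ^+ 2 <= N / xi.
    have -> : N / xi = (xi * N) * xi^-1 ^+ 2 by field; lra.
    rewrite ler_wpM2r ?sqr_ge0// (le_trans (gap_sqr_le _ cw (ltW xi0)))// ler_pM2l//.
    by rewrite gN// ltW.
  have := sqr_ge0 (gap w xi z * xi^-1 - 1); rewrite sqrrB exprMn mulr1; lra.
rewrite mulrDl divfK ?gt_eqF//; lra.
Qed.

Lemma prim_homo w : continuous w -> (forall x, 0 <= w x) -> {homo prim w : x y / x <= y}.
Proof.
move=> cw w0 x y xy; have := @gap_ge0 _ w (y - x) x cw w0.
by rewrite /gap subrKC !subr_ge0; apply.
Qed.

(** All bonds across [x] lie within distance [delta] of [x], so their gaps are at most the integral
    [J] of [w] there. In the quadratic part of the force one strain factor is bounded by [w 0];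
    Cauchy-Schwarz for [J] finishes. *)
Lemma grad_sqr_le w x : profile w ->
  grad delta w x ^+ 2 <= (delta * (1 + w 0 / 2)) ^+ 2 * (2 * delta) *
    gap (fun x => w x ^+ 2) (2 * delta) (x - delta).
Proof.
move=> pw; have [cw w0 _] := pw.
pose J := gap w (2 * delta) (x - delta).
have d20 : 0 <= 2 * delta by rewrite mulr_ge0// ltW.
have J0 : 0 <= J by exact: gap_ge0.
have C0 : 0 <= 1 + w 0 / 2 by rewrite addr_ge0// divr_ge0.
have gJ : grad delta w x <= (delta * (1 + w 0 / 2)) * J.
  rewrite mulrC mulrCA -lee_fin -[(delta * _)]mulrC -integral_D_cst// -integral_grad//.
  apply: ge0_le_integral => //.
  - by move=> xi /=; rewrite in_itv/= lee_fin => /andP[xi0 _]; exact: flux_ge0.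
  - by have /integrableP[] := flux_integrable delta x pw.
  move=> xi /=; rewrite in_itv/= lee_fin => /andP[].
  rewrite le_eqVlt => /predU1P[<-|xi0] xid.
    by rewrite flux_gap// /gap addr0 subrr mulr_ge0.
  have : flux w xi x <= (J * (1 + w 0 / 2) / xi) * xi.
    apply: flux_le => //; first exact: ltW.
    move=> z /andP[z1 z2]; rewrite /tension bond_forceE.
    have bJ : gap w xi z <= J.
      rewrite /J /gap; apply: lerB; apply: prim_homo => //; lra.
    have b0 : 0 <= gap w xi z by rewrite gap_ge0// ltW.
    have bw : gap w xi z * xi^-1 <= w 0 by rewrite ler_pdivrMr// gap_le0// ltW.
    have i0 : 0 < xi^-1 by rewrite invr_gt0.
    apply: (@le_trans _ _ (gap w xi z * (1 + w 0 / 2) * xi^-1)); last first.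
      by rewrite ler_pM2r// ler_wpM2r.
    have : (gap w xi z * xi^-1) * (gap w xi z * xi^-1) <= (gap w xi z * xi^-1) * w 0.
      by rewrite ler_wpM2l// mulr_ge0// ltW.
    lra.
  by rewrite divfK ?gt_eqF.
have : grad delta w x ^+ 2 <= ((delta * (1 + w 0 / 2)) * J) ^+ 2.
  by rewrite ler_sqr ?nnegrE ?grad_ge0// !mulr_ge0// ltW.
move=> /le_trans; apply; rewrite exprMn -mulrA ler_wpM2l ?sqr_ge0//.
by apply: gap_sqr_le => //; lra.
Qed.

(** Finiteness is what allows the gradient to be normalised in [ascent]. When [grad_sqr_le] is
    integrated, each point is counted by windows whose centres fill an interval of length
    [2 delta]. *)
Lemma grad_sqnorm_lty w : profile w -> (inner w w < +oo)%E ->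
  (inner (grad delta w) (grad delta w) < +oo)%E.
Proof.
move=> pw; have [cw w0 _] := pw.
set k := (delta * (1 + w 0 / 2)) ^+ 2 * (2 * delta).
have d20 : 0 <= 2 * delta by rewrite mulr_ge0// ltW.
have xd (x : R) : x - delta < x + delta by have := delta_gt0; lra.
have k0 : 0 <= k by rewrite /k mulr_ge0 ?sqr_ge0.
have cg := @grad_continuous R delta w pw.
have cw2 := continuous_sqr cw.
have gge0 x : 0 <= gap (fun x => w x ^+ 2) (2 * delta) (x - delta).
  by apply: gap_ge0 => // y; exact: sqr_ge0.
pose g (x : R) : \bar R := (\int[mu]_(y in `[(x - delta)%R, (x + delta)%R]) (w y ^+ 2)%:E)%E.
have gE x : g x = (gap (fun x => w x ^+ 2) (2 * delta) (x - delta))%:E.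
  rewrite /g integral_prim//; last exact: ltW.
  by rewrite /gap; congr (prim _ _ - _)%:E; ring.
have mg : measurable_fun setT (fun x => gap (fun x => w x ^+ 2) (2 * delta) (x - delta)).
  apply: continuous_measurable_fun => x.
  apply: (@continuous_comp _ _ _ (fun x => x - delta)); last exact: gap_continuous.
  by apply: cvgB; [exact: cvg_id|exact: cvg_cst].
have mg' : measurable_fun setT g.
  by rewrite (funext gE : g = _); apply/measurable_EFinP.
move=> wfin; apply: (@le_lt_trans _ _ (k%:E * \int[mu]_x g x)%E).
  rewrite -ge0_integralZl//; last by move=> x _; rewrite gE lee_fin.
  apply: ge0_le_integral => //.
  - by move=> x _; rewrite lee_fin -expr2 sqr_ge0.
  - by apply: continuous_EFin_measurable; exact: continuous_mul.
  - exact: measurable_funeM.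
  - by move=> x _; rewrite gE -EFinM lee_fin -expr2 grad_sqr_le.
have -> : (\int[mu]_x g x = (2 * delta)%:E * inner w w)%E.
  have := @window_tonelli R (cst 1%E) (fun x => (w x ^+ 2)%:E) delta delta.
  rewrite /=; under eq_integral do rewrite mul1e.
  move=> ->//; last 2 first.
  - exact: continuous_EFin_measurable.
  - by move=> x; rewrite lee_fin sqr_ge0.
  rewrite -ge0_integralZl//; last 2 first.
  - by apply: continuous_EFin_measurable; exact: continuous_mul.
  - by move=> x _; rewrite lee_fin -expr2 sqr_ge0.
  
  apply: eq_integral => x _; rewrite integral_cst//= lebesgue_measure_itv/=.
  rewrite lte_fin ifT//.
  by rewrite mul1e -EFinB -!EFinM; congr EFin; ring.
by rewrite muleA -EFinM lte_mul_pinfty// lee_fin mulr_ge0.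
Qed.

End Estimates.

(** * Convexity, scaling and the threshold of the potential *)

Section Potential.
Context {R : realType} (delta : R) (delta_gt0 : 0 < delta).
Implicit Types (v w : R -> R) (A E : set R) (x z xi : R).
Local Notation mu := (@lebesgue_measure R).
Local Notation mR := (measurableTypeR R).
Local Notation D := (`[0, delta]%classic : set R).

(** The tangent inequality, with terms added on both sides instead of subtracted, so that infinite
    integrals do no harm. *)
Lemma potential_convex v w : profile v -> profile w ->
  (potential delta w + inner (grad delta w) v <=
   potential delta v + inner (grad delta w) w)%E.
Proof.
move=> pv pw; have [cv v0 _] := pv; have [cw w0 _] := pw.
have bv := density_bond_fun cv v0; have bw := density_bond_fun cw w0.
have bt := tension_bond_fun cw w0.
have gv := gap_bond_fun cv v0; have gw := gap_bond_fun cw w0.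
have btv := bond_funM bt gv; have btw := bond_funM bt gw.
have := bint_le (delta := delta) measurableT (bond_funD bw btv) (bond_funD bv btw).
rewrite (bintD delta measurableT bw btv) (bintD delta measurableT bv btw).
rewrite (pairing delta pv pw) (pairing delta pw pw).
apply=> xi z /andP[xi0 _] _; apply: bond_energy_convex; last exact: xi0.
- exact: gw.2.
- exact: gv.2.
Qed.

Lemma potential_le_pairing w : profile w ->
  (2%:E * potential delta w <= inner (grad delta w) w)%E.
Proof.
move=> pw; have [cw w0 _] := pw.
have bw := density_bond_fun cw w0; have bt := tension_bond_fun cw w0.
have gw := gap_bond_fun cw w0.
rewrite -(pairing delta pw pw) -(bintZ delta measurableT (ler0n R 2) bw).
apply: (bint_le measurableT (bond_funZ (ler0n R 2) bw) (bond_funM bt gw)).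
by move=> xi z /andP[xi0 _] _; apply: bond_energy_le_force => //; exact: gw.2.
Qed.

Lemma profileZ k w : 0 <= k -> profile w -> profile (fun x => k * w x).
Proof.
move=> k0 [cw w0 ew]; split.
- exact: continuous_scale.
- by move=> x; rewrite mulr_ge0.
- by move=> x y xy; rewrite ler_wpM2l// ew.
Qed.

Lemma potentialZ_ge1 t w : profile w -> 1 <= t ->
  ((t ^+ 2)%:E * potential delta w <= potential delta (fun x => t * w x)%R)%E.
Proof.
move=> pw t1; have t0 : 0 <= t by exact: le_trans t1.
have [cw w0 _] := pw; have [ctw tw0 _] := profileZ t0 pw.
have bw := density_bond_fun cw w0; have gw := gap_bond_fun cw w0.
rewrite -(bintZ delta measurableT (sqr_ge0 t) bw).
apply: (bint_le measurableT (bond_funZ (sqr_ge0 t) bw) (density_bond_fun ctw tw0)).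
move=> xi z /andP[xi0 _] _; rewrite /density gapZ//.
  by apply: bond_energyZ_ge1 => //; exact: gw.2.
Qed.

Lemma potentialZ_le1 t w : profile w -> 0 <= t <= 1 ->
  ((t ^+ 3)%:E * potential delta w <= potential delta (fun x => t * w x)%R)%E.
Proof.
move=> pw t01; have /andP[t0 t1] := t01.
have [cw w0 _] := pw; have [ctw tw0 _] := profileZ t0 pw.
have bw := density_bond_fun cw w0; have gw := gap_bond_fun cw w0.
have t30 : 0 <= t ^+ 3 by exact: exprn_ge0.
rewrite -(bintZ delta measurableT t30 bw).
apply: (bint_le measurableT (bond_funZ t30 bw) (density_bond_fun ctw tw0)).
move=> xi z /andP[xi0 _] _; rewrite /density gapZ//.
  by apply: bond_energyZ_le1 => //; exact: gw.2.
Qed.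

Lemma integral_D_id k : 0 <= k ->
  (\int[mu]_(xi in D) (k * xi)%:E = (k * delta ^+ 2 / 2)%:E)%E.
Proof.
move=> k0; have ck : continuous (fun xi : R => k * xi).
  by apply: continuous_scale => x; exact: cvg_id.
have dk (x : R) : is_derive x 1 (fun x => k / 2 * (x * x)) (k * x).
  have dxx := is_deriveM (is_derive_id x (1 : R)) (is_derive_id x (1 : R)).
  have := is_deriveZ (k / 2) dxx.
  rewrite [_ *: (_ + _)](_ : _ = k * x)//.
  by rewrite /GRing.scale/= mulr1; lra.
rewrite integral_prim ?ltW// (prim_eq _ _ ck dk); congr EFin; ring.
Qed.

(* The square of [gap w xi z] is at most [xi] times the integral of [w ^+ 2] over
   [[z, z + xi]], and each point lies in such windows for [z] in a set of measure [xi]. *)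
Lemma density_window_le w A E s : profile w -> 0 <= s ->
  measurable A -> measurable E ->
  (forall xi z x, 0 <= xi <= delta -> A z -> z <= x <= z + xi -> E x) ->
  (forall xi z, 0 <= xi <= delta -> A z -> gap w xi z <= 3 * s * xi) ->
  (bint delta A (density w) <=
   ((1 + s) * (delta ^+ 2 / 4))%:E * \int[mu]_(x in E) (w x ^+ 2)%:E)%E.
Proof.
move=> pw s0 mA mE AE As; have [cw w0 _] := pw.
have bw := density_bond_fun cw w0.
have cw2 := continuous_sqr cw.
have w20 (x : R) : 0 <= w x ^+ 2 by exact: sqr_ge0.
have bg : bond_fun (gap (fun x => w x ^+ 2)) by exact: gap_bond_fun.
have mw2 (B : set mR) : measurable_fun B (fun x => (w x ^+ 2)%:E).
  exact: continuous_EFin_measurable.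
pose I := (\int[mu]_(x in E) (w x ^+ 2)%:E)%E.
have I0 : (0 <= I)%E by apply: integral_ge0 => x _; rewrite lee_fin.
have s20 : 0 <= (1 + s) / 2 by rewrite divr_ge0// addr_ge0.
apply: (@le_trans _ _ (bint delta A (fun xi z => (1 + s) / 2 * gap (fun x => w x ^+ 2) xi z))).
  apply: bint_le => //; first exact: bond_funZ.
  move=> xi z xid Az; have /andP[xi0 _] := xid.
  have b0 := gap_ge0 z cw w0 xi0.
  have bs : 0 <= gap w xi z <= 3 * s * xi by rewrite b0 As.
  apply: (le_trans (bond_energy_le s0 xi0 bs)).
  rewrite mulrA mulrAC ler_wpM2l//.
  move: xi0; rewrite le_eqVlt => /predU1P[<-|xi0].
    by rewrite invr0 mulr0 bg.2.
  by rewrite ler_pdivrMr// mulrC gap_sqr_le// ltW.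
rewrite bintZ//.
have step xi : D xi -> (\int[mu]_(z in A) (gap (fun x => w x ^+ 2) xi z)%:E <= xi%:E * I)%E.
  rewrite /= in_itv/= => xid; have /andP[xi0 _] := xid.
  (* Cutting the integrands off outside [A] and [E] allows [window_tonelli], which works on the
     whole line. *)
  pose gA (z : mR) : \bar R := (\1_A z)%:E.
  pose vE (x : mR) : \bar R := ((fun x => (w x ^+ 2)%:E) \_ E) x.
  have mgA : measurable_fun setT gA by apply/measurable_EFinP; exact: measurable_indic.
  have mvE : measurable_fun setT vE by have /(measurable_restrictT _ mE) := mw2 E.
  have gA0 z : (0 <= gA z)%E by rewrite lee_fin.
  have vE0 x : (0 <= vE x)%E by apply: erestrict_ge0 => y _; rewrite lee_fin.
  apply: (@le_trans _ _ (\int[mu]_z (gA z * \int[mu]_(x in `[(z - 0)%R, (z + xi)%R]) vE x))%E).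
    rewrite integral_mkcond; apply: ge0_le_integral => //.
    - by move=> z _; apply: erestrict_ge0 => y _; rewrite lee_fin bg.2.
    - by have /(measurable_restrictT _ mA) := @bond_fun_meas _ _ xi A bg.
    - by apply: emeasurable_funM => //; exact: window_integral_measurable.
    - move=> z _; rewrite patchE /gA indicE; case: ifPn => [Az|_]; last first.
        by rewrite mule_ge0//; apply: integral_ge0.
      rewrite mul1e subr0 -integral_prim//; last by rewrite lerDl.
      rewrite (_ : integral _ _ vE = \int[mu]_(x in `[z, (z + xi)%R]) (w x ^+ 2)%:E)%E//.
      apply: eq_integral => x; rewrite inE /vE patchE/= in_itv/= => zx.
      by rewrite mem_set//; move: zx; apply: AE => //; rewrite inE in Az.
  rewrite window_tonelli//.
  apply: (@le_trans _ _ (\int[mu]_x (xi%:E * vE x))%E).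
    apply: ge0_le_integral => //.
    - by move=> x _; rewrite mule_ge0//; apply: integral_ge0.
    - apply: emeasurable_funM => //; exact: (window_integral_measurable xi 0).
    - exact: measurable_funeM.
    - move=> x _; rewrite muleC lee_wpmul2r//.
      apply: (@le_trans _ _ (\int[mu]_(z in `[(x - xi)%R, (x + 0)%R]) 1%:E)%E).
        apply: ge0_le_integral => //; first exact: measurable_funTS.
        by move=> z _; rewrite lee_fin indicE lern1 leq_b1.
      rewrite integral_cst//= mul1e lebesgue_measure_itv/= addr0.
      case: ifPn => _; rewrite -?EFinB lee_fin//; lra.
  rewrite ge0_integralZl// /vE -integral_mkcond; exact: lexx.
have mI : measurable_fun (D : set mR) (fun xi => xi%:E * I)%E.
  by apply: emeasurable_funM => //; exact: continuous_EFin_measurable.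
apply: (@le_trans _ _ (((1 + s) / 2)%:E * \int[mu]_(xi in D) (xi%:E * I))%E).
  rewrite lee_wpmul2l ?lee_fin//; apply: ge0_le_integral => //.
  - by move=> xi Dxi; exact: bond_fun_inner_ge0 Dxi.
  - exact: bond_fun_inner_meas.
rewrite ge0_integralZr//; last by move=> xi /=; rewrite in_itv/= lee_fin => /andP[].
(* This [delta^2 / 2], multiplied by the 1/2 of the quadratic energy, is the constant [delta^2 / 4]
   of the threshold. *)
have -> : (\int[mu]_(xi in D) xi%:E = (1 * delta ^+ 2 / 2)%:E)%E.
  by rewrite -(integral_D_id ler01); apply: eq_integral => xi _; rewrite mul1r.
rewrite muleA -EFinM lee_wpmul2r// lee_fin.
by rewrite mul1r le_eqVlt; apply/orP; left; apply/eqP; field.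
Qed.

Lemma potential_le w : profile w ->
  (potential delta w <= ((1 + w 0 / 3) * (delta ^+ 2 / 4))%:E * inner w w)%E.
Proof.
move=> pw; have [cw w0 _] := pw.
rewrite (_ : inner w w = \int[mu]_(x in setT) (w x ^+ 2)%:E)%E; last first.
  by apply: eq_integral => x _; rewrite expr2.
apply: density_window_le => //; first by rewrite divr_ge0.
move=> xi z /andP[xi0 _] _; apply: (le_trans (gap_le0 _ pw xi0)).
by rewrite ler_wpM2r//; lra.
Qed.

Lemma potential_ge0 w : profile w -> (0 <= potential delta w)%E.
Proof. by move=> [cw w0 _]; apply: bint_ge0; exact: density_bond_fun. Qed.

Lemma potential_fin w : profile w -> (inner w w < +oo)%E ->
  potential delta w \is a fin_num.
Proof.
move=> pw wfin; rewrite ge0_fin_numE ?potential_ge0//.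
apply: (le_lt_trans (potential_le pw)); rewrite lte_mul_pinfty// lee_fin.
by have [_ w0 _] := pw; rewrite !(mulr_ge0, addr_ge0, exprn_ge0)// ltW.
Qed.

End Potential.

(** * Ascent along the normalised gradient *)

Section Ascent.
Context {R : realType} (delta : R) (delta_gt0 : 0 < delta).
Implicit Types (v w : R -> R) (x N K k : R).

(** The optimal choice is [k = I / Q]. The case [Q = 0] is excluded first by [k = (N + 1) / I],
    which would give [2 (N + 1) <= N]. *)
Lemma sqr_le_of_young (I Q N : R) : 0 < I -> 0 <= Q -> 0 <= N ->
  (forall k, 0 <= k -> 2 * k * I <= k ^+ 2 * Q + N) -> 0 < Q /\ I ^+ 2 <= Q * N.
Proof.
move=> I0 Q0 N0 H; have Qgt0 : 0 < Q.
  move: Q0; rewrite le_eqVlt => /predU1P[Q0|//].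
  have k0 : 0 <= (N + 1) / I by rewrite divr_ge0 ?addr_ge0// ltW.
  have := H _ k0; rewrite -Q0 mulr0 add0r.
  have -> : 2 * ((N + 1) / I) * I = 2 * (N + 1) by field; rewrite gt_eqF.
  lra.
split=> //; have k0 : 0 <= I / Q by rewrite divr_ge0// ltW.
have := H _ k0.
have -> : 2 * (I / Q) * I = 2 * (I ^+ 2 / Q) by field; rewrite gt_eqF.
have -> : (I / Q) ^+ 2 * Q = I ^+ 2 / Q by field; rewrite gt_eqF.
move=> h; have {h} : I ^+ 2 / Q <= N by lra.
by rewrite ler_pdivrMr// mulrC.
Qed.

(* By convexity the potential exceeds its tangent functional at [w], and the
   multiple of [grad w] maximises that functional on the sphere through [w]. *)
Lemma ascent w N K : profile w -> 0 < K -> inner w w = N%:E ->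
  (K%:E <= potential delta w)%E ->
  exists tau, [/\ 0 < tau, tau <= N / (2 * K),
    inner (fun x => tau * grad delta w x) (fun x => tau * grad delta w x) = N%:E,
    (potential delta w <= potential delta (fun x => tau * grad delta w x)%R)%E &
    exists I, inner (grad delta w) w = I%:E].
Proof.
move=> pw K0 wN KP; have [cw w0 _] := pw; have [cp p0 _] := grad_profile delta pw.
set p := grad delta w in cp p0 *.
have pp : profile p by exact: grad_profile.
have wfin : (inner w w < +oo)%E by rewrite wN ltry.
have qfin := grad_sqnorm_lty delta_gt0 pw wfin.
have [Q qE] : exists Q, inner p p = Q%:E.
  by exists (fine (inner p p)); rewrite fineK// ge0_fin_numE// sqnorm_ge0.
have young k : 0 <= k -> ((2 * k)%:E * inner p w <= (k ^+ 2 * Q + N)%:E)%E.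
  by move=> k0; have := inner_young cp cw p0 w0 k0; rewrite qE wN.
have [I iE] : exists I, inner p w = I%:E.
  exists (fine (inner p w)); rewrite fineK// ge0_fin_numE ?inner_ge0//.
  have := young 1 ler01; rewrite mulr1 => h.
  apply: (@le_lt_trans _ _ (2%:E * inner p w)%E); last exact: le_lt_trans h (ltry _).
  rewrite -[leLHS]mul1e lee_wpmul2r ?inner_ge0// lee_fin; lra.
have I2K : 2 * K <= I.
  rewrite -lee_fin -iE EFinM (le_trans _ (potential_le_pairing delta pw))//.
  by rewrite lee_wpmul2l.
have Q0 : 0 <= Q by rewrite -lee_fin -qE sqnorm_ge0.
have N0 : 0 <= N by rewrite -lee_fin -wN sqnorm_ge0.
have yr k : 0 <= k -> 2 * k * I <= k ^+ 2 * Q + N.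
  by move=> /young; rewrite iE -EFinM lee_fin.
have [Vw VwE] : exists a, potential delta w = a%:E.
  by exists (fine (potential delta w)); rewrite fineK// potential_fin.
have pvfin t : 0 <= t -> exists a, potential delta (fun x => t * p x) = a%:E.
  move=> t0; exists (fine (potential delta (fun x => t * p x))); rewrite fineK//.
  apply: potential_fin; [exact: delta_gt0|exact: profileZ t0 pp|].
  by rewrite sqnormZ// qE -EFinM ltry.
have pvE t : 0 <= t -> inner p (fun x => t * p x) = (t * Q)%:E.
  by move=> t0; rewrite innerZ// qE.
have psq t : inner (fun x => t * p x) (fun x => t * p x) = (t ^+ 2 * Q)%:E.
  by rewrite sqnormZ// qE.
have cvx t : 0 <= t -> (potential delta w + (t * Q)%:E <=
    potential delta (fun x => t * p x)%R + I%:E)%E.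
  move=> t0; have := @potential_convex _ delta (fun x => t * p x) w (profileZ t0 pp) pw.
  by rewrite -/p iE pvE.
have I0 : 0 < I by move: K0 I2K; clear; lra.
have [Qgt0 IQN] := sqr_le_of_young I0 Q0 N0 yr.
have Ngt0 : 0 < N.
  by rewrite -(pmulr_rgt0 _ Qgt0) (lt_le_trans _ IQN)// exprn_gt0.
pose tau := Num.sqrt (N / Q).
have tau0 : 0 < tau by rewrite sqrtr_gt0 divr_gt0.
have tau2 : tau ^+ 2 * Q = N by rewrite sqr_sqrtr ?divfK ?gt_eqF// divr_ge0// ltW.
(* The tangent functional at [w] takes the value [I] at [w] and [tau Q] at [tau p]; by
   Cauchy-Schwarz the latter is at least as large, so [cvx] gives the ascent. *)
have IQ : I <= tau * Q.
  have tQ : 0 < tau * Q by exact: mulr_gt0.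
  move: IQN; rewrite -[in X in X -> _]tau2.
  have -> : Q * (tau ^+ 2 * Q) = (tau * Q) ^+ 2 by ring.
  by rewrite ler_sqr// nnegrE ltW.
exists tau; split; first exact: tau0.
(* Here [2 K <= I], and [tau I <= tau^2 Q = N]. *)
- rewrite ler_pdivlMr ?mulr_gt0//.
  apply: (@le_trans _ _ (tau * I)); first by rewrite ler_pM2l.
  by rewrite -tau2 expr2 -mulrA ler_pM2l.
- by rewrite psq tau2.
- have := cvx _ (ltW tau0); have [b ->] := pvfin _ (ltW tau0).
  rewrite VwE -!EFinD !lee_fin; move: IQ; clear; lra.
- by exists I; exact: iE.
Qed.

Lemma ascent_bounded w N N0 K : profile w -> 0 < K -> inner w w = N%:E -> N <= N0 ->
  (K%:E <= potential delta w)%E ->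
  let M := N0 / (2 * K) * (delta * (delta / 2 + N0)) in
  exists v, [/\ profile v, inner v v = N%:E, (K%:E <= potential delta v)%E &
    forall x, v x <= M].
Proof.
move=> pw K0 wN NN0 KP M; have [tau [t0 tK vN Pv _]] := ascent pw K0 wN KP.
have pp := grad_profile delta pw.
exists (fun x => tau * grad delta w x); split.
- exact: profileZ (ltW t0) pp.
- exact: vN.
- exact: le_trans KP Pv.
- move=> x; have [_ g0 _] := pp.
  apply: ler_pM => //; first exact: ltW.
  + apply: (le_trans tK); rewrite ler_pM2r// invr_gt0 mulr_gt0//.
  + apply: grad_le => //; by rewrite wN lee_fin.
Qed.

(** The Lipschitz constant of a gradient involves the value at 0 of the profile it is taken at. The
    first ascent bounds that value by [M]; the second turns this into a Lipschitz bound in terms of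
    [N0], [K] and [delta] alone. *)
Lemma ascent_regular w N N0 K : profile w -> 0 < K -> inner w w = N%:E -> N <= N0 ->
  (K%:E <= potential delta w)%E ->
  let M := N0 / (2 * K) * (delta * (delta / 2 + N0)) in
  let L := N0 / (2 * K) * (delta * (M + M ^+ 2 / 2)) in
  exists v, [/\ profile v, inner v v = N%:E, (K%:E <= potential delta v)%E,
    forall x, v x <= M & forall x y, `|v x - v y| <= L * `|x - y|].
Proof.
move=> pw K0 wN NN0 KP M L.
have [w1 [p1 w1N K1 w1M]] := ascent_bounded pw K0 wN NN0 KP.
have [tau [t0 tK vN Pv _]] := ascent p1 K0 w1N K1.
have pp := grad_profile delta p1.
have tN : tau <= N0 / (2 * K).
  by apply: (le_trans tK); rewrite ler_pM2r// invr_gt0 mulr_gt0.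
exists (fun x => tau * grad delta w1 x); split.
- exact: profileZ (ltW t0) pp.
- exact: vN.
- exact: le_trans K1 Pv.
- move=> x; have [_ g0 _] := pp.
  apply: ler_pM => //; first exact: ltW.
  by apply: grad_le => //; rewrite w1N lee_fin.
- move=> x y; rewrite -mulrBr normrM (gtr0_norm t0) /L -mulrA.
  apply: ler_pM => //; first exact: ltW.
  apply: (le_trans (grad_lipschitz delta_gt0 x y p1)).
  have [_ w10 _] := p1.
  rewrite ler_wpM2r// ler_pM2l// /tension_max lerD//.
  by rewrite ler_pM2r// ler_sqr ?nnegrE// (le_trans (w10 0)).
Qed.

End Ascent.

(** * Compactness and semicontinuity *)

Section Compactness.
Context {R : realType}.
Implicit Types (w : R -> R) (x y Y e M L : R).

Definition locally_close w v Y e : Prop := forall x, `|x| <= Y -> `|w x - v x| <= e.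

Lemma ptws_nbhs_seq (w : {ptws R -> R}) (X : nat -> R) (m : nat) e : 0 < e ->
  nbhs w [set g : {ptws R -> R} | forall i, (i < m)%N -> `|g (X i) - w (X i)| < e].
Proof.
move=> e0; elim: m => [|m IH]; first by apply: filterS (@filterT _ (nbhs w) _) => g _ [].
have H : nbhs w [set g : {ptws R -> R} | `|g (X m) - w (X m)| < e].
  have B : nbhs (proj (X m) w) (ball (w (X m)) e) by exact: nbhsx_ballx.
  have C : nbhs w (proj (X m) @^-1` ball (w (X m)) e).
    exact: (@proj_continuous R (fun=> R) (X m) w _ B).
  apply: (@filterS _ (nbhs w) _ _ _ _ C) => g.
  by rewrite /ball/= /proj distrC.
apply: filterS (filterI IH H) => g [/= h1 h2] i; rewrite ltnS leq_eqVlt.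
by move=> /orP[/eqP->//|]; exact: h1.
Qed.

(** Tychonoff's theorem for the product of the segments [[0, M]] yields a pointwise cluster point,
    with no subsequence to extract. The common Lipschitz bound passes to it and upgrades closeness
    at finitely many points to uniform closeness on [|x| <= Y]. *)
Lemma profile_cluster (w_ : nat -> R -> R) M L : (forall n, profile (w_ n)) ->
  (forall n x, w_ n x <= M) ->
  (forall n x y, `|w_ n x - w_ n y| <= L * `|x - y|) ->
  exists w, [/\ profile w, forall x, w x <= M &
    forall Y e m, 0 < e -> exists2 n, (m <= n)%N & locally_close (w_ n) w Y e].
Proof.
move=> pw wM wL.
have cK : compact [set f : {ptws R -> R} | forall x, (`[0, M]%classic : set R) (f x)].
  by apply: (@tychonoff R (fun=> R) (fun=> `[0, M]%classic)) => _; exact: segment_compact.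
have FK : ((w_ : nat -> {ptws R -> R}) @ \oo)
    [set f : {ptws R -> R} | forall x, (`[0, M]%classic : set R) (f x)].
  exists 0%N => // n _ x; have [_ w0 _] := pw n.
  by rewrite /= in_itv/=; apply/andP; split; [exact: w0|exact: wM].
have [w [/= wK clw]] := cK _ (fmap_proper_filter _ _) FK.
have near_seq (X : nat -> R) m k e : 0 < e ->
    exists2 n, (k <= n)%N & forall i, (i < m)%N -> `|w_ n (X i) - w (X i)| < e.
  move=> e0; have tail : ((w_ : nat -> {ptws R -> R}) @ \oo)
      [set f | exists2 n, (k <= n)%N & f = w_ n].
    by exists k => // n kn; exists n.
  have [f [/= [n kn ->] H]] := clw _ _ tail (ptws_nbhs_seq w X m e0).
  by exists n.
have near2 x y e : 0 < e -> exists n, `|w_ n x - w x| < e /\ `|w_ n y - w y| < e.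
  move=> e0; have [n _ H] := near_seq (fun i => if i == 0%N then x else y) 2 0%N e e0.
  by exists n; split; [exact: (H 0%N)|exact: (H 1%N)].
have wLip x y : `|w x - w y| <= L * `|x - y|.
  apply/ler_addgt0Pr => e e0; have [n [h1 h2]] := near2 x y _ (divr_gt0 e0 (ltr0n R 2)).
  have h3 := wL n x y.
  have -> : w x - w y = - (w_ n x - w x) + (w_ n x - w_ n y) + (w_ n y - w y) by ring.
  apply: (le_trans (ler_normD _ _)); apply: (le_trans (lerD (ler_normD _ _) (lexx _))).
  rewrite normrN; move: h1 h2 h3; clear; lra.
have L0 : 0 <= L.
  by have := wL 0%N 1 0; rewrite subr0 normr1 mulr1; apply: le_trans.
have L1 : 0 < L + 1 by rewrite ltr_wpDl.
have pw' : profile w.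
  split.
  - move=> x; apply/cvgrPdist_lt => e e0; near=> y.
    apply: (le_lt_trans (wLip x y)).
    apply: (@le_lt_trans _ _ ((L + 1) * `|x - y|)); first by rewrite ler_wpM2r// lerDl.
    rewrite -ltr_pdivlMl//; near: y.
    apply/nbhs_ballP; exists ((L + 1)^-1 * e) => /=; last by move=> y.
    by rewrite mulr_gt0 ?invr_gt0.
  - by move=> x; have := wK x; rewrite in_itv/= => /andP[].
  - move=> x y xy; apply/ler_addgt0Pr => e e0.
    have [n [h1 h2]] := near2 x y _ (divr_gt0 e0 (ltr0n R 2)).
    have [_ _ ew] := pw n; have := ew x y xy.
    by move: h1 h2; rewrite !ltr_norml => /andP[? ?] /andP[? ?]; lra.
exists w; split => //.
  by move=> x; have := wK x; rewrite in_itv/= => /andP[].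
move=> Y e k e0.
have [Y0|Y0] := ltP Y 0.
  by exists k => // x; rewrite leNgt (lt_le_trans Y0).
(* Compare on a grid of mesh [h] with [L h <= e / 3]. *)
pose h := e / (3 * (L + 1)).
have h0 : 0 < h by rewrite divr_gt0// mulr_gt0.
have Lh : L * h <= e / 3.
  have -> : e / 3 = (L + 1) * h by rewrite /h; field; rewrite gt_eqF.
  by rewrite ler_pM2r// lerDl.
pose m := (Num.truncn (2 * Y / h)).+1.
have [n kn H] := near_seq (fun i => i%:R * h - Y) m k _ (divr_gt0 e0 (ltr0n R 3)).
exists n => // x; rewrite ler_norml => /andP[x1 x2].
pose i := Num.truncn ((x + Y) / h).
have xY0 : 0 <= (x + Y) / h by apply: divr_ge0; [lra|exact: ltW].
have /andP[i1 i2] := truncn_itv xY0.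
have im : (i < m)%N.
  rewrite ltnS; apply: le_truncn; rewrite ler_pM2r ?invr_gt0//; lra.
have := H i im; set a := i%:R * h - Y => Hia.
have xa : `|x - a| <= h.
  rewrite ler_norml; move: i1 i2; rewrite -/i ler_pdivlMr// ltr_pdivrMr//.
  rewrite -natr1 mulrDl mul1r /a; lra.
have h1 := le_trans (wLip x a) (le_trans (ler_wpM2l L0 xa) Lh).
have h2 := le_trans (wL n x a) (le_trans (ler_wpM2l L0 xa) Lh).
have -> : w_ n x - w x = (w_ n x - w_ n a) + (w_ n a - w a) + - (w x - w a) by ring.
apply: (le_trans (ler_normD _ _)); apply: (le_trans (lerD (ler_normD _ _) (lexx _))).
rewrite normrN; move: h1 h2 Hia; clear; lra.
Unshelve. all: by end_near. Qed.

End Compactness.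

(** * Local comparison of potentials, and tails *)

Section Semicontinuity.
Context {R : realType} (delta : R) (delta_gt0 : 0 < delta).
Implicit Types (v w : R -> R) (x Y e M N m : R).
Local Notation mu := (@lebesgue_measure R).
Local Notation mR := (measurableTypeR R).
Local Notation D := (`[0, delta]%classic : set R).

(* [mass w Y] is the integral of [w ^+ 2] over [[- Y, Y]]. *)
Definition mass w Y : R := gap (fun x => w x ^+ 2) (2 * Y) (- Y).

Lemma integral_mass w Y : continuous w -> 0 <= Y ->
  (\int[mu]_(x in `[(- Y)%R, Y]) (w x ^+ 2)%:E = (mass w Y)%:E)%E.
Proof.
move=> cw Y0; rewrite integral_prim; [|exact: continuous_sqr|lra].
by rewrite /mass /gap; congr (prim _ _ - _)%:E; ring.
Qed.

Lemma mass_le_norm w Y N : continuous w -> 0 <= Y -> (inner w w <= N%:E)%E ->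
  mass w Y <= N.
Proof. by move=> cw Y0 wN; apply: gap_sqr_le_norm => //; rewrite mulr_ge0. Qed.

Lemma norm_mass w Y : continuous w -> 0 <= Y ->
  (inner w w = (mass w Y)%:E + \int[mu]_(x in ~` `[(- Y)%R, Y]) (w x ^+ 2)%:E)%E.
Proof.
move=> cw Y0; have mi : measurable (`[- Y, Y]%classic : set mR) by [].
rewrite -integral_mass// -ge0_integral_setU//.
- by rewrite setUv; apply: eq_integral => x _; rewrite expr2.
- exact: measurableC.
- by apply: continuous_EFin_measurable; exact: continuous_sqr.
- by move=> x _; rewrite lee_fin sqr_ge0.
- by rewrite disj_set2E setICr.
Qed.

Lemma mass_homo w X Y : continuous w -> X <= Y -> mass w X <= mass w Y.
Proof.
move=> cw XY; have ch : {homo prim (fun x => w x ^+ 2) : x y / x <= y}.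
  by apply: prim_homo; [exact: continuous_sqr|move=> x; exact: sqr_ge0].
by rewrite /mass /gap lerB// ch//; lra.
Qed.

(** On [[- Y, Y]] the profile is at least [w Y], so [2 Y (w Y)^2 <= N]. *)
Lemma profile_tail w Y N eta : profile w -> (inner w w <= N%:E)%E -> 0 < Y ->
  N <= 2 * Y * eta ^+ 2 -> 0 <= eta -> w Y <= eta.
Proof.
move=> pw wN Y0 NY eta0; have [cw w0 ew] := pw.
have h := mass_le_norm cw (ltW Y0) wN; clear wN.
have : w Y ^+ 2 * (2 * Y) <= mass w Y.
  rewrite -(gap_cst _ _ (- Y)); apply: gap_le.
  - exact: cst_continuous.
  - exact: continuous_sqr.
  - by rewrite mulr_ge0// ltW.
  move=> x /andP[x1 x2]; rewrite ler_sqr ?nnegrE//; apply: ew.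
  by rewrite (gtr0_norm Y0) ler_norml; apply/andP; split; lra.
move=> /le_trans /(_ (le_trans h NY)); rewrite mulrC ler_pM2l ?mulr_gt0//.
by rewrite ler_sqr ?nnegrE.
Qed.

(** The form in which limits are taken below: an error linear in [e], with a constant of unknown
    sign. *)
Lemma le_of_linear_eps (a b c : R) : (forall e, 0 < e <= 1 -> a <= b + c * e) -> a <= b.
Proof.
move=> H; rewrite leNgt; apply/negP => ba.
have [c0|c0] := leP c 0; first by have := H 1; rewrite ltr01 lexx => /(_ isT); lra.
pose e := Num.min 1 ((a - b) / (2 * c)).
have e0 : 0 < e by rewrite lt_min ltr01 divr_gt0 ?subr_gt0 ?mulr_gt0.
have e1 : e <= 1 by rewrite ge_min lexx.
have := H e; rewrite e0 e1 => /(_ isT).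
have : c * e <= (a - b) / 2.
  have -> : (a - b) / 2 = c * ((a - b) / (2 * c)) by field; rewrite gt_eqF.
  by rewrite ler_pM2l// ge_min lexx orbT.
lra.
Qed.

Lemma norm_le_of_mass w m : continuous w -> (forall Y, 0 < Y -> mass w Y <= m) ->
  (inner w w <= m%:E)%E.
Proof.
move=> cw H; pose F (n : nat) : set mR := `[(- n.+1%:R)%R, n.+1%:R]%classic.
have ndF : nondecreasing_seq F.
  move=> i j ij; apply/subsetPset => x; rewrite /F /= !in_itv/= => /andP[h1 h2].
  have : i.+1%:R <= j.+1%:R :> R by rewrite ler_nat.
  by move=> h3; apply/andP; split; lra.
have := @ge0_nondecreasing_set_cvg_integral _ mR R F (fun x => (w x ^+ 2)%:E) mu ndF.
have -> : \bigcup_i F i = setT.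
  apply/seteqP; split => // x _; exists (Num.truncn `|x|) => //.
  rewrite /F /= in_itv/= -ler_norml; exact/ltW/truncnS_gt.
move=> /(_ (fun i => measurable_itv _)).
have mw2 (B : set mR) : measurable_fun B (fun x => (w x ^+ 2)%:E).
  by apply: continuous_EFin_measurable; exact: continuous_sqr.
have w20 i x : F i x -> (0 <= (w x ^+ 2)%:E)%E by rewrite lee_fin sqr_ge0.
move=> /(_ (fun i => mw2 _) w20) => cvgF.
rewrite (_ : inner w w = \int[mu]_(x in setT) (w x ^+ 2)%:E)%E; last first.
  by apply: eq_integral => x _; rewrite expr2.
rewrite -(cvg_lim (@ereal_hausdorff R) cvgF); apply: lime_le.
  by apply: cvgP; exact: cvgF.
by apply: nearW => n; rewrite /F integral_mass// lee_fin H.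
Qed.

Lemma mass_approx w N e Y0 : continuous w -> inner w w = N%:E -> 0 < e ->
  exists Y, [/\ 0 < Y, Y0 <= Y & N - e <= mass w Y].
Proof.
move=> cw wN e0; apply: contrapT => H.
suff : (inner w w <= (N - e)%:E)%E by rewrite wN lee_fin lerBrDl gerDr leNgt e0.
apply: norm_le_of_mass => // Y Yp.
pose Z := Num.max Y Y0.
have [NZ|/ltW/(le_trans (mass_homo cw (_ : Y <= Z)))] := leP (N - e) (mass w Z); last first.
  by apply; rewrite le_max lexx.
exfalso; apply: H; exists Z; split=> //; first by rewrite lt_max Yp.
by rewrite le_max lexx orbT.
Qed.

Lemma bint_cst (k a b : R) : a <= b ->
  (bint delta `[a, b]%classic (fun _ _ => k) = (k * (b - a) * delta)%:E)%E.
Proof.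
move=> ab; rewrite /bint -integral_D_cst//; apply: eq_integral => xi _.
rewrite integral_cst//= lebesgue_measure_itv/= lte_fin.
case: ifPn => [_|]; first by rewrite -EFinB EFinM.
by rewrite -leNgt => ba; rewrite (@le_anti _ _ a b) ?ab// subrr mulr0 mule0.
Qed.

(** Convexity at [v] bounds the loss per bond by force times difference of gaps, at most
    [(M + M^2 / 2) e xi]. Bonds based in [[- Z, Z]] reach up to [Z + delta], hence the range of
    closeness. *)
Lemma potential_local_le v w M e Z : profile v -> profile w -> (forall x, v x <= M) ->
  0 <= e -> 0 <= Z -> locally_close v w (Z + delta) e ->
  (bint delta `[(- Z)%R, Z] (density v) <=
   potential delta w + ((M + M ^+ 2 / 2) * delta * e * (2 * Z) * delta)%:E)%E.
Proof.
move=> pv pw vM e0 Z0 vw; have [cv v0 _] := pv; have [cw w0 _] := pw.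
have bv := density_bond_fun cv v0; have bw := density_bond_fun cw w0.
have mi : measurable (`[- Z, Z]%classic : set mR) by [].
have M0 : 0 <= M by exact: le_trans (vM 0).
have d0 := delta_gt0.
have G0 : 0 <= M + M ^+ 2 / 2 by rewrite addr_ge0// divr_ge0// sqr_ge0.
set k := (M + M ^+ 2 / 2) * delta * e.
have k0 : 0 <= k by rewrite /k !mulr_ge0// ltW.
have bk : bond_fun (fun _ _ : R => k) by split=> // ; exact: measurable_cst.
apply: (@le_trans _ _ (bint delta `[(- Z)%R, Z] (fun xi z => density w xi z + k))).
  apply: bint_le => //; first exact: bond_funD.
  move=> xi z /andP[xi0 xid]; rewrite /= in_itv/= => /andP[z1 z2].
  have gv0 := gap_ge0 z cv v0 xi0; have gw0 := gap_ge0 z cw w0 xi0.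
  have gvM : gap v xi z <= M * xi by apply: gap_ub.
  have fG : bond_force (gap v xi z) xi <= M + M ^+ 2 / 2.
    by apply: bond_force_le => //; rewrite gv0 gvM.
  have f0 := bond_force_ge0 gv0 xi0.
  have gd : gap v xi z <= gap w xi z + e * xi.
    have cs : continuous (fun x => w x + e).
      by move=> x; apply: cvgD; [exact: cw|exact: cvg_cst].
    have -> : gap w xi z + e * xi = gap (fun x => w x + e) xi z.
      have dP (x : R) : is_derive x 1 (prim w) (w x) by exact: prim_derive.
      have de (x : R) : is_derive x 1 (fun x => prim w x + e * x) (w x + e).
        have := is_deriveD (dP x) (is_deriveZ e (is_derive_id x (1 : R))).
        by rewrite [_ *: _]mulr1.
      by rewrite [RHS]/gap (prim_eq _ _ cs de) /gap; ring.
    apply: gap_le => // x /andP[x1 x2].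
    have /vw : `|x| <= Z + delta by rewrite ler_norml; apply/andP; split; lra.
    by rewrite ler_norml => /andP[_ h]; rewrite -lerBlDl.
  have := bond_energy_convex gv0 gw0 xi0; rewrite /density.
  have : bond_force (gap v xi z) xi * (gap v xi z - gap w xi z) <= k.
    apply: (@le_trans _ _ (bond_force (gap v xi z) xi * (e * xi))).
      by rewrite ler_wpM2l// lerBlDl.
    rewrite /k -mulrA [delta * e]mulrC; apply: ler_pM => //; first exact: mulr_ge0.
    by rewrite ler_wpM2l.
  lra.
rewrite bintD// bint_cst; last by lra.
rewrite opprK -mulr2n mulr_natl; apply: leeD; last exact: lexx.
exact: bint_subset.
Qed.

(** A bond based outside [[- (Y + delta), Y + delta]] misses [[- Y, Y]], so [v <= v Y <= 3 eta]
    along it. The cubic term then costs only the factor [1 + eta], and only the mass outside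
    [[- Y, Y]] is charged. *)
Lemma potential_far_le v eta Y N : profile v -> 0 <= eta -> 0 < Y ->
  inner v v = N%:E -> v Y <= 3 * eta ->
  (bint delta (~` `[(- (Y + delta))%R, (Y + delta)%R]) (density v) <=
   ((1 + eta) * (delta ^+ 2 / 4) * (N - mass v Y))%:E)%E.
Proof.
move=> pv eta0 Y0 vN vY; have [cv v0 ev] := pv; have d0 := delta_gt0.
have mi a b : measurable (~` `[a, b]%classic : set mR) by exact: measurableC.
have E : (\int[mu]_(x in ~` `[(- Y)%R, Y]) (v x ^+ 2)%:E = (N - mass v Y)%:E)%E.
  by rewrite EFinB -vN (norm_mass cv (ltW Y0)) [X in (X - _)%E]addeC addeK.
rewrite EFinM -E; apply: density_window_le => //; [exact: mi|exact: mi| |].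
- move=> xi z x /andP[xi0 xid] /= + /andP[zx xz]; rewrite !in_itv/= => H /andP[x1 x2].
  by apply: H; apply/andP; split; lra.
- move=> xi z /andP[xi0 xid]; rewrite /= in_itv/= => H.
  apply: gap_ub => // x /andP[zx xz]; apply: (le_trans _ vY); apply: ev.
  rewrite (gtr0_norm Y0) leNgt; apply/negP; rewrite ltr_norml => /andP[x1 x2].
  by apply: H; apply/andP; split; lra.
Qed.

(** [w^2 - v^2 = (w + v) (w - v)] is at most [2 M e], on an interval of length [2 Y]. *)
Lemma mass_close v w M e Y : profile v -> profile w -> (forall x, v x <= M) ->
  (forall x, w x <= M) -> 0 <= e -> 0 <= Y -> locally_close v w Y e ->
  mass w Y <= mass v Y + 4 * M * Y * e.
Proof.
move=> pv pw vM wM e0 Y0 vw; have [cv v0 _] := pv; have [cw w0 _] := pw.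
have M0 : 0 <= M by exact: le_trans (vM 0).
have cs : continuous (fun x => v x ^+ 2 + 2 * M * e).
  by move=> x; apply: cvgD; [exact: continuous_sqr|exact: cvg_cst].
have cv2 := continuous_sqr cv.
have dP (x : R) : is_derive x 1 (prim (fun x => v x ^+ 2)) (v x ^+ 2) by exact: prim_derive.
have de (x : R) : is_derive x 1 (fun x => prim (fun x => v x ^+ 2) x + 2 * M * e * x)
    (v x ^+ 2 + 2 * M * e).
  have := is_deriveD (dP x) (is_deriveZ (2 * M * e) (is_derive_id x (1 : R))).
  by rewrite [_ *: _]mulr1.
have -> : mass v Y + 4 * M * Y * e = gap (fun x => v x ^+ 2 + 2 * M * e) (2 * Y) (- Y).
  by rewrite [RHS]/gap (prim_eq _ _ cs de) /mass /gap; ring.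
apply: gap_le => //; [exact: continuous_sqr|by rewrite mulr_ge0|].
move=> x /andP[x1 x2].
have /vw : `|x| <= Y by rewrite ler_norml; apply/andP; split; lra.
rewrite ler_norml => /andP[h1 h2].
have : (w x + v x) * (w x - v x) <= (2 * M) * e.
  apply: (@le_trans _ _ ((w x + v x) * e)).
    by apply: ler_wpM2l; [rewrite addr_ge0|lra].
  by apply: ler_wpM2r => //; have := vM x; have := wM x; lra.
by rewrite !expr2; lra.
Qed.

End Semicontinuity.

(** * Passage to the limit, and a profile below the threshold *)

Section Limit.
Context {R : realType} (delta : R) (delta_gt0 : 0 < delta).
Implicit Types (v w : R -> R) (x Y e M N m K a n t : R).
Local Notation mu := (@lebesgue_measure R).
Local Notation mR := (measurableTypeR R).
Local Notation D := (`[0, delta]%classic : set R).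

(** The order of limits matters: [eta] determines a radius [Y], then [e] tends to 0 with [Y] fixed,
    and [eta] goes last. Central bonds are compared with those of [w], far ones are charged to the
    escaping mass, which is at most [m - mass w Y] in the limit. *)
Lemma limit_bound w M m K : profile w -> (forall x, w x <= M) ->
  (forall Y e, 0 < e -> exists v N, [/\ profile v, forall x, v x <= M,
     inner v v = N%:E /\ N <= m + e, (K%:E <= potential delta v)%E &
     locally_close v w Y e]) ->
  exists N b, [/\ inner w w = N%:E, potential delta w = b%:E, N <= m &
    K <= b + delta ^+ 2 / 4 * (m - N)].
Proof.
move=> pw wM H; have [cw w0 _] := pw; have d0 := delta_gt0.
have mass_m Y : 0 < Y -> mass w Y <= m.
  move=> Y0; apply: (@le_of_linear_eps _ _ _ (1 + 4 * M * Y)) => e /andP[e0 _].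
  have [v [N [pv vM [vN Nm] _ vw]]] := H Y e e0; have [cv _ _] := pv.
  have h1 := mass_close pv pw vM wM (ltW e0) (ltW Y0) vw.
  have h2 : mass v Y <= N by apply: mass_le_norm => //; [exact: ltW|rewrite vN].
  by move: h1 h2 Nm; clear; lra.
have wm := norm_le_of_mass cw mass_m.
have [N wN] : exists N, inner w w = N%:E.
  exists (fine (inner w w)); rewrite fineK// ge0_fin_numE ?sqnorm_ge0//.
  exact: le_lt_trans wm (ltry _).
have [b wb] : exists b, potential delta w = b%:E.
  exists (fine (potential delta w)); rewrite fineK// potential_fin//.
  by rewrite wN ltry.
have Nm : N <= m by rewrite -lee_fin -wN.
exists N, b; split=> //; clear wm.
have d2 : 0 <= delta ^+ 2 / 4 by rewrite divr_ge0// sqr_ge0.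
apply: (@le_of_linear_eps _ _ _ (delta ^+ 2 / 4 * (m - N + 2))) => eta /andP[eta0 eta1].
(* The lower bound on [Y] says [m + 1 <= 2 Y (3 eta)^2]; by [profile_tail] every approximating [v]
   then has [v Y <= 3 eta]. *)
have [Y [Y0 YY NY]] := @mass_approx _ w N eta ((m + 1) / (18 * eta ^+ 2)) cw wN eta0.
have mY := mass_m Y Y0.
have eta2 : 0 < eta ^+ 2 by rewrite exprn_gt0.
suff : K <= b + (1 + eta) * (delta ^+ 2 / 4) * (m - mass w Y).
  move=> /le_trans; apply; rewrite -addrA lerD2l.
  have -> : (1 + eta) * (delta ^+ 2 / 4) * (m - mass w Y) =
    delta ^+ 2 / 4 * ((1 + eta) * (m - mass w Y)) by ring.
  have -> : delta ^+ 2 / 4 * (m - N) + delta ^+ 2 / 4 * (m - N + 2) * eta =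
    delta ^+ 2 / 4 * (m - N + (m - N + 2) * eta) by ring.
  rewrite ler_wpM2l//.
  have : (1 + eta) * (m - mass w Y) <= (1 + eta) * (m - N + eta).
    apply: ler_wpM2l; [by rewrite addr_ge0// ltW|by move: NY; clear; lra].
  have : eta * eta <= eta by rewrite ger_pMl.
  clear; lra.
pose Z := Y + delta; pose q := (1 + eta) * (delta ^+ 2 / 4).
have q0 : 0 <= q by rewrite mulr_ge0// addr_ge0// ltW.
apply: (@le_of_linear_eps _ _ _
   ((M + M ^+ 2 / 2) * delta * (2 * Z) * delta + q * (1 + 4 * M * Y))) => e /andP[e0 e1].
have [v [Nv [pv vM [vN Nvm] Kv vw]]] := H (Z + delta) e e0; have [cv _ _] := pv.
have Z0 : 0 <= Z by rewrite /Z addr_ge0// ltW.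
have vwY : locally_close v w Y e.
  by move=> x xY; apply: vw; move: xY d0; rewrite /Z; clear; lra.
have vY : v Y <= 3 * eta.
  have vN' : (inner v v <= (m + 1)%:E)%E.
    by rewrite vN lee_fin; move: Nvm e1; clear; lra.
  apply: (profile_tail pv vN' Y0); last by rewrite mulr_ge0// ltW.
  have -> : 2 * Y * (3 * eta) ^+ 2 = Y * (18 * eta ^+ 2) by ring.
  by rewrite -ler_pdivrMr// mulr_gt0.
have mi : measurable (`[(- Z)%R, Z]%classic : set mR) by [].
have bv : bond_fun (density v) by have [_ v0 _] := pv; exact: density_bond_fun.
move: Kv; rewrite /potential (bint_setC _ mi bv) => Kv.
have h1 := potential_local_le delta_gt0 pv pw vM (ltW e0) Z0 vw.
have h2 := potential_far_le delta_gt0 pv (ltW eta0) Y0 vN vY.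
have := le_trans Kv (leeD h1 h2); rewrite wb -!EFinD lee_fin -/q => Kb.
have h3 := mass_close pv pw vM wM (ltW e0) (ltW Y0) vwY.
have h4 : q * (Nv - mass v Y) <= q * (m + e - mass w Y + 4 * M * Y * e).
  by rewrite ler_wpM2l//; move: Nvm h3; clear; lra.
by move: h4 Kb; rewrite -/q; clear; lra.
Qed.

(** [t] clamped to [[0, 1]], in a form whose continuity is that of the absolute value. *)
Definition ramp t : R := (`|t| - `|t - 1| + 1) / 2.

Lemma ramp_homo s t : s <= t -> ramp s <= ramp t.
Proof.
rewrite /ramp => st; have [] := ler0P s; have [] := ler0P t;
  have [] := ler0P (s - 1); have [] := ler0P (t - 1); lra.
Qed.

Lemma ramp0 t : t <= 0 -> ramp t = 0.
Proof. by move=> t0; rewrite /ramp !ler0_norm//; lra. Qed.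

Lemma ramp1 t : 1 <= t -> ramp t = 1.
Proof. by move=> t1; rewrite /ramp !ger0_norm//; lra. Qed.

Lemma ramp_ge0 t : 0 <= ramp t.
Proof.
have [t0|/ltW t0] := leP t 0; first by rewrite ramp0.
by rewrite -(ramp0 (lexx 0)) ramp_homo.
Qed.

Lemma ramp_le1 t : ramp t <= 1.
Proof.
have [t0|/ltW t0] := leP 1 t; first by rewrite ramp1.
by rewrite -(ramp1 (lexx 1)) ramp_homo.
Qed.

Lemma ramp_continuous : continuous ramp.
Proof.
move=> t; apply: cvgM; last exact: cvg_cst.
apply: cvgD; last exact: cvg_cst.
apply: cvgB; first by apply: (@cvg_norm _ R); exact: cvg_id.
by apply: (@cvg_norm _ R); apply: cvgB; [exact: cvg_id|exact: cvg_cst].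
Qed.

Definition plateau a n x : R := a * ramp ((n + delta - `|x|) / delta).

Lemma plateau_profile a n : 0 <= a -> profile (plateau a n).
Proof.
move=> a0; split.
- apply: continuous_scale => x.
  apply: (@continuous_comp _ _ _ (fun x => (n + delta - `|x|) / delta)); last first.
    exact: ramp_continuous.
  apply: cvgM; last exact: cvg_cst.
  apply: cvgB; first exact: cvg_cst.
  by apply: (@cvg_norm _ R); exact: cvg_id.
- by move=> x; rewrite mulr_ge0// ramp_ge0.
- move=> x y xy; rewrite ler_wpM2l// ramp_homo// ler_pM2r ?invr_gt0//.
  by rewrite lerD2l lerN2.
Qed.

Lemma plateau_norm a n : 0 <= a -> 0 <= n ->
  (inner (plateau a n) (plateau a n) <= (a ^+ 2 * (2 * (n + delta)))%:E)%E.
Proof.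
move=> a0 n0; have [cw w0 _] := plateau_profile n a0; have d0 := delta_gt0.
have nd0 : 0 <= n + delta by rewrite addr_ge0// ltW.
rewrite (norm_mass cw nd0).
rewrite [X in (_ + X)%E](_ : _ = 0%E); last first.
  apply: integral0_eq => x /=; rewrite in_itv/= => /negP H.
  rewrite /plateau ramp0 ?mulr0 ?expr0n// pmulr_lle0 ?invr_gt0// subr_le0 leNgt.
  by apply: contra H => h; rewrite -ler_norml ltW.
rewrite adde0 lee_fin; apply: gap_ub.
- exact: continuous_sqr.
- by rewrite mulr_ge0.
- move=> x _; rewrite ler_sqr ?nnegrE//.
  by rewrite -[leRHS]mulr1 ler_wpM2l// ramp_le1.
Qed.

(** Only bonds based in [[- n, n - delta]] are counted. They stay where the height is [a], so their
    energy is at least [(a^2 / 2 + a^3 / 6) xi], and [xi] integrates to [delta^2 / 2]. *)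
Lemma plateau_potential a n : 0 <= a -> delta <= 2 * n ->
  (((2 * n - delta) * (delta ^+ 2 / 4) * (a ^+ 2 * (1 + a / 3)))%:E <=
   potential delta (plateau a n))%E.
Proof.
move=> a0 dn; have pw := plateau_profile n a0; have [cw w0 _] := pw.
have d0 := delta_gt0; have bw := density_bond_fun cw w0.
have mi : measurable (`[(- n)%R, n - delta]%classic : set mR) by [].
pose k := a ^+ 2 / 2 + a ^+ 3 / 6.
have k0 : 0 <= k by rewrite /k addr_ge0// divr_ge0// exprn_ge0.
have bk : bond_fun (fun xi _ : R => k * xi).
  split; last by move=> xi _ xi0; exact: mulr_ge0.
  by apply: measurable_funM => //; exact: measurable_fst.
apply: le_trans (bint_subset delta mi bw).
apply: (@le_trans _ _ (bint delta `[(- n)%R, n - delta]%classic (fun xi _ => k * xi))).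
  rewrite /bint.
  under eq_integral => xi _.
    rewrite integral_cst//= lebesgue_measure_itv/= lte_fin.
    over.
  rewrite (_ : (fun _ => _) = (fun xi : R => ((k * (2 * n - delta)) * xi)%:E)).
    rewrite integral_D_id//; last by rewrite mulr_ge0// subr_ge0.
    by rewrite lee_fin le_eqVlt; apply/orP; left; apply/eqP; rewrite /k; field.
  apply/funext => xi; case: ifPn => [_|]; first by rewrite -EFinB -EFinM; congr EFin; ring.
  rewrite -leNgt => h; have -> : 2 * n - delta = 0 by move: h dn; clear; lra.
  by rewrite mulr0 mul0r mule0.
apply: bint_le => //.
move=> xi z /andP[xi0 xid]; rewrite /= in_itv/= => /andP[z1 z2].
have gw0 := gap_ge0 z cw w0 xi0.
have ga : a * xi <= gap (plateau a n) xi z.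
  rewrite -(gap_cst a xi z); apply: gap_le => //; first exact: cst_continuous.
  move=> x /andP[x1 x2] /=; rewrite /plateau ramp1 ?mulr1//.
  rewrite ler_pdivlMr// mul1r.
  have : `|x| <= n by rewrite ler_norml; apply/andP; split; lra.
  by move: d0; clear; lra.
have ax0 : 0 <= a * xi by rewrite mulr_ge0.
have f0 := bond_force_ge0 ax0 xi0.
have := bond_energy_convex ax0 gw0 xi0; rewrite /density.
have : bond_force (a * xi) xi * (a * xi) <= bond_force (a * xi) xi * gap (plateau a n) xi z.
  by rewrite ler_wpM2l.
have -> : bond_energy (a * xi) xi = k * xi.
  move: xi0; rewrite le_eqVlt => /predU1P[<-|xi0].
    by rewrite /bond_energy !mulr0 !expr0n/= !mul0r addr0.
  by rewrite /bond_energy /k; field; rewrite gt_eqF.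
by clear; lra.
Qed.

(** For effective length [l] the squared norm is at most [a^2 (l + 3 delta)], against the threshold
    value [a^2 (l + l a / 3)]. Keeping the potential at [K] makes [l] grow like [a^-2], so for small
    [a] the cubic gain [l a / 3] beats the boundary loss [3 delta]. *)
Lemma low_norm_profile K : 0 < K -> exists w N,
  [/\ profile w, inner w w = N%:E, (K%:E <= potential delta w)%E &
      N * (delta ^+ 2 / 4) < K].
Proof.
move=> K0; have d0 := delta_gt0.
pose k := 4 * K / delta ^+ 2.
have k0 : 0 < k by rewrite divr_gt0 ?mulr_gt0 ?exprn_gt0.
(* Chosen so that [a <= 1] and [k = a k + 12 delta a], hence [k > 12 delta a]. *)
pose a := k / (k + 12 * delta).
have s0 : 0 < k + 12 * delta by apply: addr_gt0 => //; exact: mulr_gt0.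
have a0 : 0 < a by rewrite divr_gt0.
have aE : a * k + 12 * (delta * a) = k by rewrite /a; field; rewrite gt_eqF.
have a1 : a <= 1 by rewrite ler_pdivrMr// mul1r lerDl mulr_ge0// ltW.
have c0 : 0 < a ^+ 2 * (1 + a / 3).
  by rewrite mulr_gt0 ?exprn_gt0// addr_gt0// divr_gt0.
(* The length at which the bound of [plateau_potential] equals [K]. *)
pose l := k / (a ^+ 2 * (1 + a / 3)).
have l0 : 0 < l by rewrite divr_gt0.
have lE : l * (a ^+ 2 * (1 + a / 3)) = k by rewrite divfK// gt_eqF.
pose n := (l + delta) / 2.
have n0 : 0 <= n by rewrite divr_ge0// addr_ge0// ltW.
have pw := plateau_profile n (ltW a0).
have wN := plateau_norm (ltW a0) n0.
have [N NE] : exists N, inner (plateau a n) (plateau a n) = N%:E.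
  exists (fine (inner (plateau a n) (plateau a n))); rewrite fineK//.
  by rewrite ge0_fin_numE ?sqnorm_ge0// (le_lt_trans wN) ?ltry.
exists (plateau a n), N; split=> //.
  have dn : delta <= 2 * n by rewrite /n; move: l0; clear; lra.
  apply: le_trans (plateau_potential (ltW a0) dn); rewrite lee_fin.
  have -> : 2 * n - delta = l by rewrite /n; field.
  rewrite mulrAC lE /k le_eqVlt; apply/orP; left; apply/eqP.
  by field; rewrite gt_eqF.
move: wN; rewrite NE lee_fin => wN.
have KE : K = k * (delta ^+ 2 / 4) by rewrite /k; field; rewrite gt_eqF.
rewrite KE ltr_pM2r ?divr_gt0 ?exprn_gt0//; apply: (le_lt_trans wN).
rewrite -lE /n.
have -> : a ^+ 2 * (2 * ((l + delta) / 2 + delta)) = a ^+ 2 * (l + 3 * delta) by field.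
have -> : l * (a ^+ 2 * (1 + a / 3)) = a ^+ 2 * (l + l * a / 3) by field.
rewrite ltr_pM2l ?exprn_gt0// ltrD2l.
(* [9 delta < l a], as [l a * a (1 + a / 3) = k > 12 delta a] *)
have : 9 * delta * (a * (1 + a / 3)) < l * a * (a * (1 + a / 3)).
  have -> : l * a * (a * (1 + a / 3)) = k by rewrite -lE; ring.
  have da0 : 0 < delta * a by exact: mulr_gt0.
  have ak : 0 < a * k by exact: mulr_gt0.
  have : delta * a * a <= delta * a by rewrite ger_pMr.
  by move: aE da0 ak; clear; lra.
rewrite ltr_pM2r; last by rewrite mulr_gt0// addr_gt0// divr_gt0.
by clear; lra.
Qed.

End Limit.

(** * The minimiser *)

Section Minimiser.
Context {R : realType} (delta : R) (delta_gt0 : 0 < delta).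
Implicit Types (v w : R -> R) (x Y e M N m K a t : R).

Definition admissible K w N : Prop :=
  [/\ profile w, inner w w = N%:E & (K%:E <= potential delta w)%E].

Lemma admissible_gt0 K w N : 0 < K -> admissible K w N -> 0 < N.
Proof.
move=> K0 [pw wN KP].
have N0 : 0 <= N by rewrite -lee_fin -wN sqnorm_ge0.
rewrite lt_neqAle N0 andbT; apply/negP => /eqP N00.
have := le_trans KP (potential_le delta_gt0 pw).
by rewrite wN -N00 mule0 lee_fin leNgt K0.
Qed.

Lemma minimiser_exists K : 0 < K -> exists w m, admissible K w m /\
  forall v N, admissible K v N -> m <= N.
Proof.
move=> K0; have d0 := delta_gt0.
pose S : set R := [set N | exists w, admissible K w N].
have S0 N : S N -> 0 <= N by move=> [w aw]; exact/ltW/(admissible_gt0 K0 aw).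
have [w0 [N0 [pw0 wN0 KP0 N0K]]] := low_norm_profile delta_gt0 K0.
have S_N0 : S N0 by exists w0; split; [exact: pw0|exact: wN0|exact: KP0].
have infS : has_inf S by split; [exists N0|exists 0 => N; exact: S0].
pose m := inf S.
have m_lb v N : admissible K v N -> m <= N.
  by move=> av; apply: ge_inf; [exact: infS.2|exists v].
have m0 : 0 <= m by apply: lb_le_inf; [exact: infS.1|move=> N; exact: S0].
have d2 : 0 < delta ^+ 2 / 4 by rewrite divr_gt0// exprn_gt0.
have mK : m * (delta ^+ 2 / 4) < K.
  apply: le_lt_trans N0K; rewrite ler_pM2r//.
  by apply: ge_inf; [exact: infS.2|exact: S_N0].
pose M := (m + 1) / (2 * K) * (delta * (delta / 2 + (m + 1))).
pose L := (m + 1) / (2 * K) * (delta * (M + M ^+ 2 / 2)).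
have seqP (n : nat) : exists p : (R -> R) * R, [/\ admissible K p.1 p.2,
    p.2 <= m + n.+1%:R^-1, (forall x, p.1 x <= M) &
    forall x y, `|p.1 x - p.1 y| <= L * `|x - y|].
  have n0 : 0 < n.+1%:R^-1 :> R by rewrite invr_gt0.
  have [N [w [pw wN KP]] Nm] := inf_adherent n0 infS.
  have Nm1 : N <= m + 1.
    apply: (le_trans (ltW Nm)); rewrite lerD2l invf_le1 ?ler1n//.
  have [v [pv vN KPv vM vL]] := ascent_regular delta_gt0 pw K0 wN Nm1 KP.
  exists (v, N); split; [|exact: ltW|exact: vM|exact: vL].
  by split; [exact: pv|exact: vN|exact: KPv].
have [W_ HW] := choice seqP.
have Wp n : profile (W_ n).1 by have [[]] := HW n.
have WM n : forall x, (W_ n).1 x <= M by have [] := HW n.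
have WL n : forall x y, `|(W_ n).1 x - (W_ n).1 y| <= L * `|x - y| by have [] := HW n.
have [w [pw wM cl]] := profile_cluster Wp WM WL.
have [N [b [wN wb Nm Kb]]] : exists N b, [/\ inner w w = N%:E,
    potential delta w = b%:E, N <= m & K <= b + delta ^+ 2 / 4 * (m - N)].
  apply: (limit_bound delta_gt0 pw wM) => Y e e0.
  (* From index [k] on, the excess [n.+1%:R^-1] over the infimum is at most [e]. *)
  pose k := Num.truncn e^-1.
  have [n kn vw] := cl Y e k e0.
  have [[pv vN KPv] Nn vM _] := HW n.
  exists (W_ n).1, (W_ n).2.
  split; [exact: pv|exact: vM|split; first exact: vN|exact: KPv|exact: vw].
  apply: (le_trans Nn); rewrite lerD2l invf_ple ?posrE//.
  by apply: (le_trans (ltW (truncnS_gt _))); rewrite ler_nat ltnS.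
have N_ge0 : 0 <= N by rewrite -lee_fin -wN sqnorm_ge0.
(* If [N = 0], then [b <= 0] and [Kb] reads [K <= b + m delta^2 / 4], against [mK]. *)
have Npos : 0 < N.
  rewrite lt_neqAle N_ge0 andbT; apply/negP => /eqP N00.
  have := potential_le delta_gt0 pw; rewrite wN wb -N00 mule0 lee_fin.
  by move: Kb mK; rewrite -N00 subr0; clear; lra.
pose t := Num.sqrt (m / N).
have t2 : t ^+ 2 * N = m by rewrite sqr_sqrtr ?divfK ?gt_eqF// divr_ge0.
have t21 : 1 <= t ^+ 2 by rewrite sqr_sqrtr ?divr_ge0// ler_pdivlMr// mul1r.
have t1 : 1 <= t by rewrite -(expr_ge1 (n := 2)) ?sqrtr_ge0.
have t0 : 0 <= t by exact: sqrtr_ge0.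
have [cw _ _] := pw.
exists (fun x => t * w x), m; split; last exact: m_lb.
split; first exact: profileZ t0 pw.
  by rewrite sqnormZ// wN -EFinM t2.
apply: le_trans (potentialZ_ge1 delta pw t1).
rewrite wb -EFinM lee_fin.
apply: (@le_trans _ _ (t ^+ 2 * (K - delta ^+ 2 / 4 * (m - N)))); last first.
  by apply: ler_wpM2l; [exact: sqr_ge0|move: Kb; clear; lra].
(* Since [t^2 N = m], the dependence on [t] is confined to a multiple of [K - m delta^2 / 4],
   positive by [mK]; so [t^2 >= 1] suffices. *)
have -> : t ^+ 2 * (K - delta ^+ 2 / 4 * (m - N)) =
   t ^+ 2 * (K - m * (delta ^+ 2 / 4)) + delta ^+ 2 / 4 * m.
  rewrite -[X in _ = _ + delta ^+ 2 / 4 * X]t2; ring.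
have : 1 * (K - m * (delta ^+ 2 / 4)) <= t ^+ 2 * (K - m * (delta ^+ 2 / 4)).
  by apply: ler_wpM2r => //; rewrite subr_ge0 ltW.
by clear; lra.
Qed.

(** A [v] with potential above [K] could be shrunk slightly: the potential falls at most like the
    cube of the factor, while the squared norm drops below [m]. This is applied both to the
    minimiser and to its normalised gradient. *)
Lemma minimiser_potential_le K w m v : 0 < K -> admissible K w m ->
  (forall v N, admissible K v N -> m <= N) -> profile v -> inner v v = m%:E ->
  (potential delta v <= K%:E)%E.
Proof.
move=> K0 aw min pv vm; have m0 := admissible_gt0 K0 aw; have [cv _ _] := pv.
have [b vb] : exists b, potential delta v = b%:E.
  exists (fine (potential delta v)); rewrite fineK// potential_fin//.
  by rewrite vm ltry.
rewrite vb lee_fin leNgt; apply/negP => Kb.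
have b0 : 0 < b by exact: lt_trans Kb.
(* Bernoulli's inequality then gives [(1 - s)^3 >= 1 - 3 s = K / b]. *)
pose s := (1 - K / b) / 3.
have Kb1 : K / b < 1 by rewrite ltr_pdivrMr// mul1r.
have Kb0 : 0 < K / b by rewrite divr_gt0.
have s0 : 0 < s by rewrite /s; move: Kb1; clear; lra.
have s1 : s < 1 by rewrite /s; move: Kb0; clear; lra.
have t01 : 0 <= 1 - s <= 1 by apply/andP; split; move: s0 s1; clear; lra.
have [t0 t1] := andP t01.
have at_ : admissible K (fun x => (1 - s) * v x) ((1 - s) ^+ 2 * m).
  split; first exact: profileZ t0 pv.
    by rewrite sqnormZ// vm.
  apply: le_trans (potentialZ_le1 delta pv t01); rewrite vb -EFinM lee_fin.
  rewrite -ler_pdivrMr//.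
  have -> : K / b = 1 - 3 * s by rewrite /s; field; rewrite gt_eqF.
  have -> : (1 - s) ^+ 3 = 1 - 3 * s + s ^+ 2 * (3 - s) by ring.
  by rewrite lerDl mulr_ge0 ?sqr_ge0//; move: s1; clear; lra.
have := min _ _ at_; rewrite leNgt => /negP; apply.
rewrite gtr_pMl// expr_lt1//; move: s0; clear; lra.
Qed.

Lemma euler_lagrange K w m : 0 < K -> admissible K w m ->
  (forall v N, admissible K v N -> m <= N) ->
  potential delta w = K%:E /\
  exists2 tau, 0 < tau & forall x, w x = tau * grad delta w x.
Proof.
move=> K0 aw min; have [pw wm KP] := aw; have [cw w0 _] := pw.
have PK : potential delta w = K%:E.
  by apply/eqP; rewrite eq_le KP andbT (minimiser_potential_le K0 aw min).
split; first exact: PK.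
have [tau [t0 _ vm Pv [I iE]]] := ascent delta_gt0 pw K0 wm KP.
exists tau; first exact: t0.
have pp := grad_profile delta pw.
move: pp iE Pv vm (potential_convex delta (profileZ (ltW t0) pp) pw).
move: (grad delta w) => p pp iE Pv vm.
have [cp p0 _] := pp; have pv := profileZ (ltW t0) pp; have [cv v0 _] := pv.
have KPv := minimiser_potential_le K0 aw min pv vm.
have -> : potential delta (fun x => tau * p x) = K%:E.
  by apply/eqP; rewrite eq_le KPv -PK Pv.
(* With equal potentials the tangent inequality becomes [tau Q <= I], the reverse of
   Cauchy-Schwarz. *)
rewrite PK iE innerZ ?(ltW t0)//.
have [Q QE] : exists Q, inner p p = Q%:E.
  have : inner p p \is a fin_num.
    rewrite ge0_fin_numE ?sqnorm_ge0// ltey; apply/eqP => ppoo.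
    by move: vm; rewrite sqnormZ// ppoo gt0_muley// lte_fin exprn_gt0.
  by move=> /fineK <-; exists (fine (inner p p)).
rewrite QE -EFinM -!EFinD lee_fin lerD2l => QI.
have tQ : tau ^+ 2 * Q = m by move: vm; rewrite sqnormZ// QE -EFinM => -[].
have d2 : inner (fun x => tau * p x - w x) (fun x => tau * p x - w x) = 0%E.
  apply/eqP; rewrite eq_le sqnorm_ge0 andbT.
  have cd : continuous (fun x => tau * p x - w x).
    by move=> x; apply: cvgB; [exact: cv|exact: cw].
  (* The square is expanded with the mixed term on the left, so that only nonnegative functions are
     integrated. The norm is then [2 m - 2 tau I <= 2 m - 2 tau^2 Q = 0]. *)
  have E : (inner (fun x => tau * p x - w x)%R (fun x => tau * p x - w x)%R +
      (2 * tau)%:E * inner p w = (m + m)%:E)%E.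
    rewrite EFinD -{1}vm -wm.
    rewrite -ge0_integralZl//; last 3 first.
    - by apply: continuous_EFin_measurable; exact: continuous_mul.
    - by move=> x _; rewrite lee_fin mulr_ge0.
    - by rewrite lee_fin mulr_ge0// ltW.
    rewrite -ge0_integralD//; last 4 first.
    - by move=> x _; rewrite lee_fin -expr2 sqr_ge0.
    - by apply: continuous_EFin_measurable; exact: continuous_mul.
    - by move=> x _; rewrite lee_fin !mulr_ge0// ltW.
    - by apply: measurable_funeM; apply: continuous_EFin_measurable; exact: continuous_mul.
    rewrite -ge0_integralD//; last 4 first.
    - by move=> x _; rewrite lee_fin -expr2 sqr_ge0.
    - by apply: continuous_EFin_measurable; exact: continuous_mul.
    - by move=> x _; rewrite lee_fin -expr2 sqr_ge0.
    - by apply: continuous_EFin_measurable; exact: continuous_mul.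
    by apply: eq_integral => x _; rewrite -EFinM -!EFinD; congr EFin; ring.
  move: E; rewrite iE -EFinM.
  move=> /(congr1 (fun X => X - (2 * tau * I)%:E)%E); rewrite addeK// => ->.
  rewrite -EFinB lee_fin -tQ.
  have : tau * (tau * Q) <= tau * I by rewrite ler_pM2l.
  by rewrite expr2; clear; lra.
move=> x; have := sqnorm_eq0 (w := fun x => tau * p x - w x) x _ d2.
move=> H; apply/eqP; rewrite eq_sym -subr_eq0; apply/eqP; apply: H => y.
by apply: cvgB; [exact: cv|exact: cw].
Qed.

End Minimiser.

(** * The travelling wave *)

Section Wave.
Context {R : realType} (delta : R) (delta_gt0 : 0 < delta).
Implicit Types (w : R -> R) (b x z xi t : R).
Local Notation mu := (@lebesgue_measure R).
Local Notation mR := (measurableTypeR R).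
Local Notation D := (`[0, delta]%classic : set R).

Lemma ge0_integral_reflect (g : mR -> \bar R) (a b : R) :
  measurable_fun `[a, b]%classic g -> (forall x, a <= x <= b -> (0 <= g x)%E) ->
  (\int[mu]_(x in `[(- b)%R, (- a)%R]) g (- x)%R = \int[mu]_(x in `[a, b]) g x)%E.
Proof.
move=> mg g0.
rewrite (_ : `[- b, - a]%classic = (-%R : mR -> mR) @^-1` `[a, b]); last first.
  by apply/seteqP; split => x /=; rewrite !in_itv/= lerNl lerNr andbC.
rewrite -ge0_integral_pushforward//=.
  by apply: eq_measure_integral => A mA _; exact: lebesgue_measureN.
by move=> x; rewrite inE/= in_itv; exact: g0.
Qed.

Lemma W_energy b xi : 0 <= b -> 0 <= xi -> W (- b) xi = bond_energy b xi.
Proof.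
move=> b0; rewrite le_eqVlt => /predU1P[<-|xi0].
  rewrite /W /bond_energy normr0 !(mulr0, invr0, expr0n)/= ?mulr0.
  by case: ifPn; rewrite ?mul0r ?addr0.
rewrite /W /bond_energy (gtr0_norm xi0) mulNr oppr_lt0.
move: b0; rewrite le_eqVlt => /predU1P[<-|b0].
  by rewrite mul0r ltxx oppr0 !expr0n/= !mul0r addr0.
by rewrite divr_gt0//; field; rewrite gt_eqF.
Qed.

Lemma f_tension b xi : 0 <= b -> 0 <= xi -> f (- b) xi = - bond_force b xi.
Proof.
move=> b0; rewrite le_eqVlt => /predU1P[<-|xi0].
  by rewrite /f sgr0 mulr0 /bond_force !(mulr0, invr0, expr0n)/= ?mulr0 ?addr0 ?oppr0.
rewrite /f /F (gtr0_sg xi0) mulr1 mulNr oppr_lt0.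
move: b0; rewrite le_eqVlt => /predU1P[<-|b0].
  by rewrite mul0r ltxx /bond_force oppr0 expr0n/= !mul0r addr0 oppr0.
by rewrite divr_gt0// /bond_force; field; rewrite gt_eqF.
Qed.

Lemma f_odd b xi : f (- b) (- xi) = - f b xi.
Proof. by rewrite /f invrN mulrNN sgrN mulrN. Qed.

Lemma potential_energy_prim w : profile w ->
  potential_energy delta (fun x => - prim w x) = potential delta w.
Proof.
move=> [cw w0 _]; have bw := density_bond_fun cw w0.
rewrite [RHS](bint_swap delta measurableT bw).
apply: eq_integral => z _; apply: eq_integral => xi.
rewrite inE/= in_itv/= => /andP[xi0 _]; rewrite /density -W_energy//; last exact: gap_ge0.
by congr (W _ _)%:E; rewrite /gap; ring.
Qed.

Lemma tension0 w z : tension w 0 z = 0.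
Proof. by rewrite /tension bond_forceE /gap addr0 subrr !(mul0r, expr0n, addr0). Qed.

(** For [xi < 0] the bond is the one of length [- xi] based at [z + xi], seen from its right end;
    [f_odd] accounts for the sign. *)
Lemma f_wave w z xi : profile w ->
  f (- prim w (z + xi) - - prim w z) xi =
  if 0 <= xi then - tension w xi z else tension w (- xi) (z + xi).
Proof.
move=> [cw w0 _]; case: ifPn => [xi0|]; last rewrite -ltNge => /ltW xi0.
  have -> : - prim w (z + xi) - - prim w z = - gap w xi z by rewrite /gap; ring.
  by rewrite f_tension//; exact: gap_ge0.
have nx0 : 0 <= - xi by rewrite oppr_ge0.
have -> : - prim w (z + xi) - - prim w z = gap w (- xi) (z + xi).
  by rewrite /gap addrK opprK addrC.
have gap0 := gap_ge0 (z + xi) cw w0 nx0.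
rewrite -[LHS]opprK -f_odd f_tension ?opprK//.
Qed.

Lemma integral_f_wave w z : profile w ->
  mu.-integrable `[(- delta)%R, delta]
    (EFin \o (fun xi => f (- prim w (z + xi) - - prim w z) xi)) /\
  \int[mu]_(xi in `[- delta, delta]) f (- prim w (z + xi) - - prim w z) xi =
  - slope delta w z.
Proof.
move=> pw; have [cw w0 _] := pw; have d0 := delta_gt0.
have [mt t0] := tension_bond_fun cw w0.
pose g xi := if 0 <= xi then - tension w xi z else tension w (- xi) (z + xi).
have fE : (fun xi => f (- prim w (z + xi) - - prim w z) xi) = g.
  by apply/funext => xi; exact: f_wave.
rewrite fE.
have mt1 : measurable_fun setT (fun xi : mR => tension w xi z).
  exact: (measurable_fun_pair1 (z : mR) mt).
have mt2 : measurable_fun setT (fun s : mR => tension w s (z - s)).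
  have ms : measurable_fun setT (fun s : mR => (s, z - s) : mR * mR).
    by apply: measurable_fun_pair => //; exact: measurable_funB.
  exact: (measurableT_comp mt ms).
have mt3 : measurable_fun setT (fun s : mR => tension w (- s) (z + s)).
  have mN : measurable_fun setT (fun s : mR => - s) by exact: measurable_funN.
  have := measurableT_comp mt2 mN.
  by apply: eq_measurable_fun => s _ /=; rewrite opprK.
have mg : measurable_fun setT g.
  apply: measurable_fun_ifT => //.
  - by apply: measurable_fun_ler => //; exact: measurable_cst.
  - exact: measurable_funN.
have ig : mu.-integrable `[(- delta)%R, delta] (EFin \o g).
  apply: (@le_integrable _ _ _ mu _ _ _ (EFin \o cst (tension_max w))) => //.
  - by apply/measurable_EFinP; apply: measurable_funTS.
  - move=> xi _ /=; rewrite lee_fin [leRHS]ger0_norm ?tension_max_ge0// /g.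
    case: ifPn => [xi0|]; first by rewrite normrN ger0_norm ?t0// tension_le.
    rewrite -ltNge => /ltW xi0; rewrite ger0_norm ?t0 ?oppr_ge0// tension_le//.
    by rewrite oppr_ge0.
  - by apply: continuous_itv_integrable; exact: cst_continuous.
split=> //.
have := @Rintegral_itvB _ g (BLeft (- delta)) (BRight delta) 0 ig.
rewrite !bnd_simp oppr_le0 (ltW d0) => /(_ isT isT).
have igD : mu.-integrable `]0, delta] (EFin \o g).
  apply: integrableS ig => //; apply: subset_itvr; rewrite bnd_simp; lra.
rewrite Rintegral_itv_obnd_cbnd// => /eqP; rewrite subr_eq => /eqP ->.
have -> : \int[mu]_(x in `[0, delta]) g x = \int[mu]_(x in `[0, delta]) - tension w x z.
  by apply: eq_Rintegral => xi; rewrite inE/= in_itv/= /g => /andP[-> _].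
(* Substitution [s = - xi]. At the common endpoint [g] takes the branch for [0 <= xi]; the two agree
   there by [tension0]. *)
have -> : \int[mu]_(x in `[- delta, 0]) g x = \int[mu]_(s in `[0, delta]) tension w s (z - s).
  rewrite /Rintegral -(@ge0_integral_reflect (fun s => (tension w s (z - s))%:E) 0 delta) ?oppr0.
  - congr fine; apply: eq_integral => xi; rewrite inE/= in_itv/= => /andP[_ xi0].
    rewrite /g opprK; case: ifPn => // xi0'.
    have -> : xi = 0 by apply: le_anti; rewrite xi0 xi0'.
    by rewrite !oppr0 !tension0 oppr0.
  - by apply/measurable_EFinP; apply: measurable_funTS.
  - by move=> xi /andP[xi0 _]; rewrite lee_fin t0.
have bd (h : R -> R) : measurable_fun setT (h : mR -> R) ->
    (forall xi, 0 <= xi -> 0 <= h xi <= tension_max w) -> mu.-integrable D (EFin \o h).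
  move=> mh hb; apply: (@le_integrable _ _ _ mu _ _ _ (EFin \o cst (tension_max w))) => //.
  - by apply/measurable_EFinP; apply: measurable_funTS.
  - move=> xi /=; rewrite in_itv/= => /andP[/hb/andP[h0 hM] _].
    by rewrite lee_fin !ger0_norm// (le_trans h0).
  - by apply: continuous_itv_integrable; exact: cst_continuous.
have i1 : mu.-integrable D (EFin \o (fun xi => tension w xi z)).
  by apply: bd => // xi xi0; rewrite t0 ?tension_le.
have i2 : mu.-integrable D (EFin \o (fun xi => tension w xi (z - xi))).
  by apply: bd => // xi xi0; rewrite t0 ?tension_le.
rewrite /slope RintegralB// opprB addrC; congr (_ + _).
rewrite -mulN1r -RintegralZl//; apply: eq_Rintegral => xi _.
by rewrite mulN1r.
Qed.

End Wave.

Section Solution.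
Context {R : realType} (delta : R) (delta_gt0 : 0 < delta).
Implicit Types (w : R -> R) (c x z t : R).

(** The equation for [w] makes it differentiable with derivative [tau * slope delta w]. Hence the
    second time derivative is [- c^2 tau] times [slope], and [c^2 = 1 / tau] matches the force
    integral [- slope] from [integral_f_wave]. *)
Lemma wave_solution w tau : profile w -> 0 < tau ->
  (forall x, w x = tau * grad delta w x) ->
  peridynamic_solution delta
    (fun x t => - prim w (x - Num.sqrt tau^-1 * t)).
Proof.
move=> pw tau0 wE x t; have [cw w0 _] := pw.
set c := Num.sqrt tau^-1.
have c2 : c * c = tau^-1 by rewrite -expr2 sqr_sqrtr// ltW// invr_gt0.
have dP (y : R) : is_derive y 1 (fun y => - prim w y) (- w y).
  by apply: is_deriveN; exact: prim_derive.
have dw (y : R) : is_derive y 1 w (tau * slope delta w y).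
  have dg : is_derive y 1 (grad delta w) (slope delta w y) by exact: grad_derive.
  have := is_deriveZ tau dg; congr (is_derive _ _ _ _).
  by apply/funext => s; rewrite [RHS]wE.
have uE : (fun t => - prim w (x - c * t)) = (fun s => - prim w (x + - c * s)).
  by apply/funext => s; rewrite mulNr.
have du (s : R) : is_derive s 1 (fun t => - prim w (x - c * t)) (c * w (x + - c * s)).
  have := @is_derive_affine _ (fun y => - prim w y) (fun y => - w y) x (- c) s dP.
  by rewrite uE mulrNN.
have u1 : derive1 (fun t => - prim w (x - c * t)) = (fun s => c * w (x + - c * s)).
  by apply/funext => s; rewrite derive1E; have [] := du s.
have du2 : is_derive t 1 (fun s => c * w (x + - c * s)) (- slope delta w (x - c * t)).
  have da := @is_derive_affine _ _ _ x (- c) t dw.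
  have := is_deriveZ c da.
  rewrite [_ *: _](_ : _ = - slope delta w (x - c * t)) ?mulNr//.
  rewrite /GRing.scale/= !(mulNr, mulrN) !mulrA c2 mulVf ?gt_eqF// mul1r//.
have [ig E] := integral_f_wave delta_gt0 (x - c * t) pw.
have sh xi : x + xi - c * t = x - c * t + xi by ring.
split.
- by have [] := du t.
- by rewrite u1; have [] := du2.
- by move: ig; congr (_.-integrable _ _); apply/funext => xi; rewrite /= sh.
- rewrite /derive1n /= u1 derive1E; have [_ ->] := du2.
  by rewrite -E; apply: eq_Rintegral => xi _; rewrite sh.
Qed.

End Solution.

Theorem theorem2 (R : realType) (delta : R) (delta_gt0 : 0 < delta)
    (K : R) (K_gt0 : 0 < K) :
  exists (u : R -> R -> R) (c : R) (q : R -> R),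
    monotone_travelling_wave delta u c q /\ potential_energy delta q = K%:E.
Proof.
have [w [m [aw min]]] := minimiser_exists delta_gt0 K_gt0.
have [PK [tau tau0 wE]] := euler_lagrange delta_gt0 K_gt0 aw min.
have [pw _ _] := aw; have [cw w0 _] := pw.
exists (fun x t => - prim w (x - Num.sqrt tau^-1 * t)), (Num.sqrt tau^-1),
  (fun x => - prim w x); split; last by rewrite potential_energy_prim.
split.
- by rewrite gt_eqF// sqrtr_gt0 invr_gt0.
- by right => x y xy; rewrite lerN2; exact: prim_homo.
- by [].
- exact: wave_solution.
Qed.
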